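(* Let $k$ and $r$ be two positive integers with $r<k$, and let $G$ be a connected graph of order $n$ with minimum degree $\delta(G)=\delta$ and $$n\geq\max\Big\{\frac{(k+r)(k+2r)(k\delta+k+r)}{k^{2}r},\ \frac{2kr\delta^{2}+(2k^{2}+kr+2r^{2})\delta+k^{2}+3kr-2r^{2}}{2r(k-r)}\Big\}.$$ If $$\rho(G)\geq\rho\Big(K_{\delta}\vee\Big(K_{n-\lfloor\frac{k\delta}{r}\rfloor-\delta-1}\cup\Big(\Big\lfloor\frac{k\delta}{r}\Big\rfloor+1\Big)K_1\Big)\Big),$$ then $G$ has a $\{C_{2i+1},T:1\leq i<\frac{r}{k-r},\,T\in\mathcal{T}_{\frac{k}{r}}\}$-factor unless $G=K_{\delta}\vee(K_{n-\lfloor\frac{k\delta}{r}\rfloor-\delta-1}\cup(\lfloor\frac{k\delta}{r}\rfloor+1)K_1)$.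
   Context: All graphs are finite and undirected, without loops or multiple edges. The order of a graph is its number of vertices; $V(G)$, $E(G)$ are the vertex set and edge set of $G$. $\rho(G)$ denotes the adjacency spectral radius of $G$, i.e. the largest eigenvalue of the adjacency matrix $A(G)$. $K_m$ is the complete graph of order $m$, and $C_m$ is the circuit (cycle) of order $m$. $G_1\cup G_2$ is the (disjoint) union of $G_1$ and $G_2$, $mK_1$ is the union of $m$ copies of $K_1$ ($m$ isolated vertices), and the join $G_1\vee G_2$ is obtained from $G_1\cup G_2$ by joining each vertex of $G_1$ with each vertex of $G_2$ by an edge. Equality of graphs means isomorphism. $\lfloor c\rfloor$ is the greatest integer not exceeding $c$. $i(G)$ denotes the number of isolated vertices of $G$. $G-S$ is the subgraph induced by $V(G)\setminus S$, and $T-e$ is $T$ with the edge $e$ deleted. A tree is a connected graph without circuits. For positive integers $r<k$, $\mathcal{T}_{\frac{k}{r}}$ denotes the set of trees $T$ such that (1) $i(T-S)\leq\frac{k}{r}|S|$ for any $S\subset V(T)$ (including $S=\emptyset$), and (2) for any $e\in E(T)$ there exists a set $S^{*}\subset V(T)$ (possibly empty) with $i((T-e)-S^{*})>\frac{k}{r}|S^{*}|$. For a set $\mathcal{H}$ of connected graphs, an $\mathcal{H}$-factor of $G$ is a subgraph $H$ of $G$ with $V(H)=V(G)$ such that each component of $H$ is isomorphic to an element of $\mathcal{H}$. The $\{C_{2i+1},T:1\leq i<\frac{r}{k-r},\,T\in\mathcal{T}_{\frac{k}{r}}\}$-factor is the case where $\mathcal{H}$ consists of all odd cycles $C_{2i+1}$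 with $i$ an integer satisfying $1\leq i<\frac{r}{k-r}$, together with all trees $T\in\mathcal{T}_{\frac{k}{r}}$. *)

(* Defs.v *)
From mathcomp Require Import all_boot all_order all_algebra.
From mathcomp Require Import classical_sets reals.

Set Implicit Arguments.
Unset Strict Implicit.
Unset Printing Implicit Defensive.

Import Order.TTheory GRing.Theory Num.Theory.

Record sgraph (V : finType) := SGraph {
  edge :> rel V;
  edge_sym : symmetric edge;
  edge_irr : irreflexive edge }.

Definition graph_iso (U V : finType) (G : sgraph U) (H : sgraph V) : Prop :=
  exists2 f : U -> V, bijective f & forall x y, H (f x) (f y) = G x y.

Section Basic.
Variables (V : finType) (G : sgraph V).

Definition degree (x : V) : nat := #|[pred y | G x y]|.

(* Every degree is below #|V|, so the default value #|V| is only reached on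
   the graph without vertices. *)
Definition min_degree : nat := \big[minn/#|V|]_(x : V) degree x.

Definition connected_graph : Prop :=
  (0 < #|V|)%N /\ forall x y : V, connect G x y.

(* A [ucycle] of length 2 is an edge traversed back and forth and one of
   length at most 1 carries no edge, hence the bound 2. *)
Definition acyclic_graph : Prop :=
  forall c : seq V, ucycle G c -> (size c <= 2)%N.

Definition is_tree : Prop := connected_graph /\ acyclic_graph.

Definition num_isolated : nat := #|[pred x | [forall y, ~~ G x y]]|.

Definition component (x : V) : {set V} := [set y in connect G x].

Section Induced.
Variable A : {set V}.

Definition induced_edge : rel {x : V | x \in A} :=
  fun x y => G (val x) (val y).

Lemma induced_sym : symmetric induced_edge.
Proof. by move=> x y; apply: edge_sym. Qed.

Lemma induced_irr : irreflexive induced_edge.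
Proof. by move=> x; apply: edge_irr. Qed.

Definition induced : sgraph {x : V | x \in A} := SGraph induced_sym induced_irr.
End Induced.

Definition del_vertices (S : {set V}) := induced (~: S).

Section DelEdge.
Variables x y : V.

Definition del_edge_rel : rel V :=
  fun u v => G u v && ([set u; v] != [set x; y]).

Lemma del_edge_sym : symmetric del_edge_rel.
Proof. by move=> u v; rewrite /del_edge_rel edge_sym finset.setUC. Qed.

Lemma del_edge_irr : irreflexive del_edge_rel.
Proof. by move=> u; rewrite /del_edge_rel edge_irr. Qed.

Definition del_edge : sgraph V := SGraph del_edge_sym del_edge_irr.
End DelEdge.

Local Open Scope ring_scope.

Definition adjmx (R : realType) : 'M[R]_#|V| :=
  \matrix_(i, j) (G (enum_val i) (enum_val j))%:R.

(* The largest eigenvalue: the adjacency matrix is real symmetric, so for a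
   graph with at least one vertex its set of real eigenvalues is finite and
   nonempty, and the supremum is a maximum. *)
Definition spectral_radius (R : realType) : R :=
  sup [set a : R | eigenvalue (adjmx R) a]%classic.

End Basic.

Section Complete.
Variable m : nat.

Definition complete_edge : rel 'I_m := fun u v => u != v.

Lemma complete_sym : symmetric complete_edge.
Proof. by move=> u v; rewrite /complete_edge eq_sym. Qed.

Lemma complete_irr : irreflexive complete_edge.
Proof. by move=> u; rewrite /complete_edge eqxx. Qed.

Definition complete_graph : sgraph 'I_m := SGraph complete_sym complete_irr.

Lemma edgeless_sym : symmetric (fun _ _ : 'I_m => false). Proof. by []. Qed.

Lemma edgeless_irr : irreflexive (fun _ _ : 'I_m => false). Proof. by []. Qed.

Definition edgeless_graph : sgraph 'I_m := SGraph edgeless_sym edgeless_irr.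

(* This is the circuit of order m when m >= 3; [u != v] only matters for
   m = 1. *)
Definition circuit_edge : rel 'I_m :=
  fun u v => (u != v) && ((ordS u == v) || (ordS v == u)).

Lemma circuit_sym : symmetric circuit_edge.
Proof. by move=> u v; rewrite /circuit_edge eq_sym orbC. Qed.

Lemma circuit_irr : irreflexive circuit_edge.
Proof. by move=> u; rewrite /circuit_edge eqxx. Qed.

Definition circuit : sgraph 'I_m := SGraph circuit_sym circuit_irr.
End Complete.

Section UnionJoin.
Variables (U V : finType) (G : sgraph U) (H : sgraph V).

Definition union_edge : rel (U + V)%type := fun a b =>
  match a, b with
  | inl x, inl y => G x y
  | inr x, inr y => H x y
  | _, _ => false
  end.

Lemma union_sym : symmetric union_edge.
Proof. by move=> [x|x] [y|y] //=; apply: edge_sym. Qed.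

Lemma union_irr : irreflexive union_edge.
Proof. by move=> [x|x] /=; apply: edge_irr. Qed.

Definition graph_union : sgraph (U + V)%type := SGraph union_sym union_irr.

Definition join_edge : rel (U + V)%type := fun a b =>
  match a, b with
  | inl x, inl y => G x y
  | inr x, inr y => H x y
  | _, _ => true
  end.

Lemma join_sym : symmetric join_edge.
Proof. by move=> [x|x] [y|y] //=; apply: edge_sym. Qed.

Lemma join_irr : irreflexive join_edge.
Proof. by move=> [x|x] /=; apply: edge_irr. Qed.

Definition graph_join : sgraph (U + V)%type := SGraph join_sym join_irr.
End UnionJoin.

Definition graph_class : Type := forall V : finType, sgraph V -> Prop.

Definition has_factor (F : graph_class) (V : finType) (G : sgraph V) : Prop :=
  exists H : sgraph V, subrel H G /\
    forall x : V, exists (U : finType) (K : sgraph U),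
      F U K /\ graph_iso (induced H (component H x)) K.

Local Open Scope ring_scope.

Definition tree_class (k r : nat) : graph_class := fun V T =>
  [/\ is_tree T,
      forall S : {set V},
        (num_isolated (del_vertices T S))%:R
          <= k%:R / r%:R * #|S|%:R :> rat
    & forall x y : V, T x y ->
        exists S : {set V},
          (num_isolated (del_vertices (del_edge T x y) S))%:R
            > k%:R / r%:R * #|S|%:R :> rat].

Definition cycle_tree_class (k r : nat) : graph_class := fun V H =>
  (exists i : nat,
     [/\ (1 <= i)%N, i%:R < r%:R / (k%:R - r%:R) :> rat
       & graph_iso H (circuit (2 * i + 1))])
  \/ tree_class k r H.

(* K_d \/ (K_(n - floor(kd/r) - d - 1) U (floor(kd/r) + 1) K_1), of order n as
   soon as n >= floor(kd/r) + d + 1; the subtractions are truncated below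
   that. *)
Definition extremal_graph (k r d n : nat) :=
  graph_join (complete_graph d)
    (graph_union (complete_graph (n - (k * d) %/ r - d - 1)%N)
                 (edgeless_graph ((k * d) %/ r + 1)%N)).

(* Main.v *)
Require Import Defs.
From mathcomp Require Import all_boot all_order all_algebra.
From mathcomp Require Import boolp reals.
From mathcomp Require Import zify ring lra.

(** The proof has two independent halves.

    Factors. A graph satisfying [i(G - S) <= (k/r) |S|] for every S has the required
    factor ([isolation_bound_factor]). The bound is equivalent to the existence of
    nonnegative edge weights for which every vertex has load, the sum of the
    weights at it, between r and k ([fractional_factor_isolation],
    [isolation_fractional_factor]; the hard direction is an augmenting path
    argument, [balanced_flow]). Choose an edge-minimal spanning subgraph satisfying
    the bound. There, no change of the weights that respects the load bounds can
    annihilate an edge. This makes the incidence map from edge weights to loads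
    injective ([load_kernel0]), so every cycle is odd; an odd cycle makes the map
    surjective on its component, which excludes leaves there ([deg_neq1]). Counting
    dimensions, such a component has all degrees 2, so it is the cycle itself
    ([deg_eq2], [component_circuit]), and its length is limited because a long odd
    cycle could lose an edge ([cycle_length]). Acyclic
    components lie in the required class of trees by minimality
    ([tree_component]).

    Spectrum. If G violates the bound at some S with s vertices, then the minimum
    degree delta is at most s, and G is a subgraph of a block graph: a hub S joined
    to everything, a clique, and floor(ks/r) + 1 independent sinks
    ([isolation_failure_parts]). All comparisons use positive vectors: if
    [A z <= theta z] with z positive, then theta bounds all eigenvalues, strictly if
    the graph is connected and the inequality is strict at some vertex
    ([eigenvalue_le], [eigenvalue_lt]). The extremal graph is the block graph with
    s = delta; with a = floor(k delta/r) + 1, the cubic equation of its quotient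
    provides an eigenvalue larger than n - a - 1 with a positive eigenvector
    ([quotient_root], [block_spectral]). If s = delta, this vector shows that a G
    different from the extremal graph has smaller spectral radius. If s > delta,
    an explicit vector gives [rho(G) <= n - a - 1] ([large_hub_spectral]) as soon as
    [s t (s + t - a) <= (t - a) (n - a) (n - a - 1)], where t = floor(ks/r) + 1, and
    this inequality follows from the assumption on n ([order_condition]). *)

Set Implicit Arguments.
Unset Strict Implicit.
Unset Printing Implicit Defensive.

Import Order.TTheory GRing.Theory Num.Theory.

(** * Components *)

Section Components.
Variables (V : finType) (H : sgraph V).

Lemma component_closed x : closed H (mem (component H x)).
Proof.
move=> u v uv; rewrite /= !inE; apply/idP/idP => h.
  by apply: connect_trans h (connect1 uv).
by apply: connect_trans h (connect1 _); rewrite edge_sym.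
Qed.

Lemma component_eq x y : y \in component H x -> component H x = component H y.
Proof.
rewrite inE => xy; apply/setP => z; rewrite !inE.
by apply: same_connect xy z; apply: sym_connect_sym; apply: edge_sym.
Qed.

Lemma component_connected x : connected_graph (induced H (component H x)).
Proof.
have xC : x \in component H x by rewrite inE; exact: connect0.
split; first by apply/card_gt0P; exists (Sub x xC).
move=> u v.
have : connect H (val u) (val v).
  have := valP u; have := valP v; rewrite !inE => xv xu; apply: connect_trans xv.
  by rewrite (sym_connect_sym (@edge_sym _ H)).
case/connectP => p; elim: p u => [|z p IH] u /= => [_ /val_inj -> //|/andP [uz pth] lst].
have zC : z \in component H x.
  by rewrite -(component_closed _ uz); apply: valP.
apply: (@connect_trans _ _ (Sub z zC)); first by apply: connect1.
exact: IH.
Qed.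

Lemma ucycle_induced (C : {set V}) c : ucycle (induced H C) c -> ucycle H (map val c).
Proof.
case/andP => cyc unq; rewrite /ucycle map_inj_uniq ?unq ?andbT; last exact: val_inj.
by case: c cyc {unq} => //= x p; rewrite -map_rcons; apply: homo_path.
Qed.

End Components.

(** * Isolated vertices and balanced flows *)

Section Isolated.
Variables (V : finType) (G : sgraph V).

Definition isolated_off (S : {set V}) : {set V} :=
  [set x | (x \notin S) && [forall y, G x y ==> (y \in S)]].

Lemma isolated_offP (S : {set V}) x :
  reflect (x \notin S /\ forall y, G x y -> y \in S) (x \in isolated_off S).
Proof.
rewrite inE; apply: (iffP andP) => -[xS H]; split=> //.
  by move=> y; move/forallP: H => /(_ y) /implyP.
by apply/forallP=> y; apply/implyP; apply: H.
Qed.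

Lemma num_isolated_del (S : {set V}) :
  num_isolated (del_vertices G S) = #|isolated_off S|.
Proof.
rewrite /num_isolated -(card_image val_inj); apply: eq_card => x.
apply/imageP/isolated_offP => [[y yI ->]|[xS xN]].
  move: yI; rewrite inE => /forallP yN; split; first by have := valP y; rewrite inE.
  move=> z yz; apply/negPn/negP => zS.
  have zS' : z \in ~: S by rewrite inE.
  by have := yN (Sub z zS'); rewrite /= /induced_edge /= yz.
have xS' : x \in ~: S by rewrite inE.
exists (Sub x xS') => //; rewrite inE; apply/forallP=> y; apply/negP => /xN.
by have := valP y; rewrite inE => /negP.
Qed.

End Isolated.

(** [i(G - S) <= (k/r) |S|] for all S, with the denominator cleared. *)
Definition isolation_bound (r k : nat) (V : finType) (G : sgraph V) : bool :=
  [forall S : {set V}, r * #|isolated_off G S| <= k * #|S|].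

Section Flow.
Variables (V : finType) (G : sgraph V) (r k : nat).
Hypothesis le_rk : r <= k.

Definition nbrs (X : {set V}) : {set V} := [set y | [exists x in X, G x y]].

(** The vertices of X without a neighbour in X are isolated after deleting
    N(X) \ X; the other vertices of X belong to N(X) and cost at most k each
    because r <= k. *)
Lemma isolation_bound_Hall (X : {set V}) :
  isolation_bound r k G -> r * #|X| <= k * #|nbrs X|.
Proof.
move=> /forallP /(_ (nbrs X :\: X)) H.
have sub : X :\: nbrs X \subset isolated_off G (nbrs X :\: X).
  apply/subsetP=> x /setDP [xX xN]; apply/isolated_offP; split.
    by rewrite inE xX.
  move=> y xy; rewrite inE; apply/andP; split; last first.
    by rewrite inE; apply/existsP; exists x; rewrite xX.
  apply: contra xN => yX; rewrite inE; apply/existsP; exists y.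
  by rewrite yX edge_sym.
have := leq_trans (leq_mul (leqnn r) (subset_leq_card sub)) H.
rewrite -(cardsID (nbrs X) X) -(cardsID X (nbrs X)) [nbrs X :&: X]setIC.
have := leq_mul le_rk (leqnn #|X :&: nbrs X|).
nia.
Qed.

Implicit Type h : V -> V -> nat.

Definition outflow h x := \sum_y h x y.
Definition inflow h y := \sum_x h x y.
Definition on_arcs h := forall x y, 0 < h x y -> G x y.
(** One step of an augmenting path: x pushes a unit more into some y, which in
    exchange refuses a unit from x'. *)
Definition residual h : rel V := fun x x' => [exists y, G x y && (0 < h x' y)].

Definition add_arc h x0 y0 x y := h x y + ((x == x0) && (y == y0)).
Definition sub_arc h x0 y0 x y := h x y - ((x == x0) && (y == y0)).

Lemma outflow_add h x0 y0 x :
  outflow (add_arc h x0 y0) x = outflow h x + (x == x0).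
Proof.
rewrite /outflow big_split /=; congr addn; case: (x == x0) => /=.
  by rewrite -big_mkcond /= big_pred1_eq.
by rewrite big1.
Qed.

Lemma inflow_add h x0 y0 y :
  inflow (add_arc h x0 y0) y = inflow h y + (y == y0).
Proof.
rewrite /inflow big_split /=; congr addn; case: (y == y0) => /=.
  under eq_bigr do rewrite andbT.
  by rewrite -big_mkcond /= big_pred1_eq.
by rewrite big1 // => x _; rewrite andbF.
Qed.

Lemma sub_arcK h x0 y0 x y : 0 < h x0 y0 ->
  add_arc (sub_arc h x0 y0) x0 y0 x y = h x y.
Proof.
move=> h0; rewrite /add_arc /sub_arc subnK //.
by case: andP => // -[/eqP-> /eqP->].
Qed.

Lemma outflow_sub h x0 y0 x : 0 < h x0 y0 ->
  outflow (sub_arc h x0 y0) x + (x == x0) = outflow h x.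
Proof.
by move=> h0; rewrite -(outflow_add _ x0 y0); apply: eq_bigr => y _; apply: sub_arcK.
Qed.

Lemma inflow_sub h x0 y0 y : 0 < h x0 y0 ->
  inflow (sub_arc h x0 y0) y + (y == y0) = inflow h y.
Proof.
by move=> h0; rewrite -(inflow_add _ x0 y0); apply: eq_bigr => x _; apply: sub_arcK.
Qed.

(** Only the targets of the steps matter for the augmentation below, whence the
    asymmetric hypothesis. *)
Lemma path_sub_targets (e e' : rel V) x p :
  (forall u w, w \in p -> e u w -> e' u w) -> path e x p -> path e' x p.
Proof.
elim: p x => //= y p IH x H /andP [xy pth]; rewrite H ?mem_head //=.
by apply: IH pth => u w wp; apply: H; rewrite inE wp orbT.
Qed.

(** Rerouting along a simple residual path moves one unit of outflow from its
    last vertex to its first one and leaves every inflow unchanged. *)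
Lemma augment h x0 p : on_arcs h -> path (residual h) x0 p -> uniq (x0 :: p) ->
  exists h', [/\ on_arcs h', forall y, inflow h' y = inflow h y
    & forall x, outflow h' x + (x == last x0 p) = outflow h x + (x == x0)].
Proof.
elim: p h x0 => [|x1 p IH] h x0 sup; first by exists h.
case/andP=> /existsP [y /andP [x0y h1y]] pth /andP [x0p unq].
pose h1 := sub_arc (add_arc h x0 y) x1 y.
have h1y' : 0 < add_arc h x0 y x1 y by rewrite /add_arc addn_gt0 h1y.
have [||h' [sup' col' row']] := IH h1 x1 _ _ unq.
- move=> u w; rewrite /h1 /sub_arc /add_arc.
  have [/andP [/eqP-> /eqP->] _ //|_] := boolP ((u == x0) && (w == y)).
  rewrite addn0 => huw; apply: sup; apply: leq_trans huw _; exact: leq_subr.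
(* the unit is taken off an arc out of x1, and x1 does not recur on the path,
   so the arcs used by the later steps keep their flow *)
- case/andP: unq => x1p _; apply: path_sub_targets pth => u w wp.
  case/existsP=> z /andP [uz hwz]; apply/existsP; exists z; rewrite uz.
  have wx1 : w == x1 = false by apply: contraNF x1p => /eqP <-.
  by rewrite /h1 /sub_arc wx1 subn0 addn_gt0 hwz.
exists h'; split=> //.
- move=> w; rewrite col'; apply/eqP.
  by rewrite -(eqn_add2r (w == y)) /h1 inflow_sub // inflow_add.
- by move=> x; rewrite row' /h1 outflow_sub // outflow_add.
Qed.

Definition capacity_le h := (forall x, outflow h x <= k) /\ (forall y, inflow h y <= k).
Definition coverage h := \sum_x (minn (outflow h x) r + minn (inflow h x) r).

Lemma coverage_lt h h' x0 :
  (forall x, minn (outflow h x) r + minn (inflow h x) r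
     <= minn (outflow h' x) r + minn (inflow h' x) r) ->
  minn (outflow h x0) r + minn (inflow h x0) r
     < minn (outflow h' x0) r + minn (inflow h' x0) r ->
  coverage h < coverage h'.
Proof.
move=> le lt; rewrite /coverage (bigD1 x0) //= [X in _ < X](bigD1 x0) //=.
by rewrite -addSn leq_add // leq_sum.
Qed.

(** Search from x0 in the residual relation. A reached vertex with outflow above
    r can spare a unit, and a reached arc into an unsaturated vertex can carry
    one more; either way the total coverage grows. If neither occurs, the reached
    set X violates the Hall condition. *)
Lemma raise_outflow h x0 : isolation_bound r k G ->
  on_arcs h -> capacity_le h -> outflow h x0 < r ->
  exists h', [/\ on_arcs h', capacity_le h' & coverage h < coverage h'].
Proof.
move=> Gok sup [rowk colk] x0r.
have [X XP] : exists X : {set V}, X = [set x | connect (residual h) x0 x] by exists [set x | connect (residual h) x0 x].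
have x0X : x0 \in X by rewrite XP inE.
have reach x : x \in X -> exists h', [/\ on_arcs h', forall y, inflow h' y = inflow h y
    & forall v, outflow h' v + (v == x) = outflow h v + (v == x0)].
  rewrite XP inE => /connectP [p pth ->].
  by case/shortenP: pth => p' pth' unq _; apply: augment.
have [[x [xX rx]]|norow] := pselect (exists x, x \in X /\ r < outflow h x).
  have [h' [sup' col' row']] := reach x xX.
  have ne : x == x0 = false by apply/negP => /eqP E; move: rx; rewrite E; lia.
  have ne' : x0 == x = false by rewrite eq_sym.
  exists h'; split=> //.
    split=> [v|y]; last by rewrite col'.
    have := row' v; have := rowk v; case: (v =P x0) => [->|_]; rewrite ?ne'; lia.
  apply: (@coverage_lt _ _ x0) => [v|].
    rewrite col'; have := row' v; case: (v =P x) => [->|_]; rewrite ?ne; lia.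
  by have := row' x0; rewrite col' eqxx ne'; lia.
have [[y [yN yk]]|nocol] := pselect (exists y, y \in nbrs X /\ inflow h y < k).
  move: yN; rewrite inE => /existsP [x /andP [xX xy]].
  have [h' [sup' col' row']] := reach x xX.
  have row v : outflow (add_arc h' x y) v = outflow h v + (v == x0).
    by rewrite outflow_add.
  have col v : inflow (add_arc h' x y) v = inflow h v + (v == y).
    by rewrite inflow_add col'.
  exists (add_arc h' x y); split.
  - move=> u v; rewrite /add_arc.
    by have [/andP [/eqP-> /eqP->]//|_] := boolP ((u == x) && (v == y)); rewrite addn0; apply: sup'.
  - split=> v; rewrite (row, col).
      by have := rowk v; case: eqP => [->|_]; lia.
    by have := colk v; case: eqP => [->|_]; lia.
  - apply: (@coverage_lt _ _ x0) => [v|]; rewrite row col; first by lia.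
    by rewrite eqxx; lia.
(* no augmentation is possible: the out-neighbours of X are saturated, and only
   by flow out of X, so that k |N(X)| < r |X| *)
exfalso.
have := isolation_bound_Hall X Gok; apply/negP; rewrite -ltnNge.
have -> : k * #|nbrs X| = \sum_(y in nbrs X) k by rewrite sum_nat_const mulnC.
have le1 : \sum_(y in nbrs X) k <= \sum_(y in nbrs X) \sum_(x in X) h x y.
  apply: leq_sum => y yN.
  have <- : inflow h y = \sum_(x in X) h x y.
    rewrite /inflow (bigID (mem X)) /= [X in _ + X]big1 ?addn0 // => x xX.
    apply/eqP; rewrite -leqn0 leqNgt; apply: contra xX => hxy.
    move: yN; rewrite inE => /existsP [x1 /andP [x1X x1y]].
    move: x1X; rewrite XP !inE => /connect_trans; apply; apply: connect1.
    by apply/existsP; exists y; rewrite x1y.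
  by rewrite leqNgt; apply/negP => yk; apply: nocol; exists y.
apply: leq_ltn_trans le1 _; rewrite exchange_big /=.
have -> : r * #|X| = \sum_(x in X) r by rewrite sum_nat_const mulnC.
rewrite (bigD1 x0) //= [X in _ < X](bigD1 x0) //= -addSn; apply: leq_add.
  apply: leq_ltn_trans x0r; rewrite /outflow [X in _ <= X](bigID (mem (nbrs X))) /=.
  exact: leq_addr.
apply: leq_sum => x /andP [xX _].
apply: (@leq_trans (outflow h x)).
  rewrite /outflow [X in _ <= X](bigID (mem (nbrs X))) /=; exact: leq_addr.
by rewrite leqNgt; apply/negP => rx; apply: norow; exists x.
Qed.

(** Reverse all arcs. *)
Lemma raise_inflow h x0 : isolation_bound r k G ->
  on_arcs h -> capacity_le h -> inflow h x0 < r ->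
  exists h', [/\ on_arcs h', capacity_le h' & coverage h < coverage h'].
Proof.
move=> Gok sup [rowk colk] x0r.
have sup' : on_arcs (fun x y => h y x) by move=> x y /sup; rewrite edge_sym.
have [h' [sup1 [r1 c1] cov]] := raise_outflow Gok sup' (conj colk rowk) x0r.
exists (fun x y => h' y x); split=> //; first by move=> x y /sup1; rewrite edge_sym.
have cT f : coverage (fun x y => f y x) = coverage f.
  by apply: eq_bigr => x _; exact: addnC.
by rewrite -cT (cT h').
Qed.

(** A flow of maximum coverage within the capacities: the coverage is at most
    [2 r |V|], and while some outflow or inflow is below r it can be raised
    without lowering what is already covered. Getting both lower bounds in the
    same flow is what allows to symmetrise it into edge weights later. *)
Lemma balanced_flow : isolation_bound r k G ->
  exists h, [/\ on_arcs h, forall x, r <= outflow h x <= k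
               & forall y, r <= inflow h y <= k].
Proof.
move=> Gok.
have cov_le h : coverage h <= #|V| * (r + r).
  rewrite -sum_nat_const; apply: leq_sum => x _; lia.
suff H m h : on_arcs h -> capacity_le h -> #|V| * (r + r) - coverage h <= m ->
    exists h, [/\ on_arcs h, forall x, r <= outflow h x <= k
               & forall y, r <= inflow h y <= k].
  apply: (H _ (fun _ _ => 0)) (leqnn _) => //.
  by split=> x; rewrite /outflow /inflow big1.
elim: m h => [|m IH] h sup cap le.
all: have [[x lt]|ok1] := pselect (exists x, outflow h x < r);
  first by have [h' [sup' cap' lt']] := raise_outflow Gok sup cap lt;
    have le' := cov_le h'; (exfalso + apply: (IH h')) => //; lia.
all: have [[x lt]|ok2] := pselect (exists x, inflow h x < r);
  first by have [h' [sup' cap' lt']] := raise_inflow Gok sup cap lt;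
    have le' := cov_le h'; (exfalso + apply: (IH h')) => //; lia.
all: case: cap => c1 c2; exists h; split=> // x; apply/andP; split=> //;
  rewrite leqNgt; apply/negP => lt; by [apply: ok1; exists x | apply: ok2; exists x].
Qed.
End Flow.

(** * Edge sets and fractional factors *)

Section EdgeSets.
Variable V : finType.
Implicit Types (E : {set {set V}}) (x y : V).

Definition edges (G : sgraph V) : {set {set V}} :=
  [set [set p.1; p.2] | p in [pred p : V * V | G p.1 p.2]].

Definition edge_set_rel E : rel V := fun x y => (x != y) && ([set x; y] \in E).

Lemma edge_set_sym E : symmetric (edge_set_rel E).
Proof. by move=> x y; rewrite /edge_set_rel eq_sym finset.setUC. Qed.

Lemma edge_set_irr E : irreflexive (edge_set_rel E).
Proof. by move=> x; rewrite /edge_set_rel eqxx. Qed.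

Definition graph_of E : sgraph V := SGraph (@edge_set_sym E) (@edge_set_irr E).

Lemma eq_pair (a b x y : V) : [set a; b] = [set x; y] ->
  (a = x /\ b = y) \/ (a = y /\ b = x).
Proof.
move=> e.
have : a \in [set x; y] by rewrite -e set21.
have : b \in [set x; y] by rewrite -e set22.
have : x \in [set a; b] by rewrite e set21.
have : y \in [set a; b] by rewrite e set22.
rewrite !inE => /orP [] /eqP -> /orP [] /eqP -> /orP [] /eqP ? /orP [] /eqP ?; subst; auto.
Qed.

Lemma edgesP (G : sgraph V) e :
  reflect (exists x y, G x y /\ e = [set x; y]) (e \in edges G).
Proof.
apply: (iffP imsetP) => [[[x y] /= Gxy ->]|[x [y [Gxy ->]]]].
  by exists x, y.
by exists (x, y).
Qed.

Lemma graph_of_edges (G : sgraph V) x y : graph_of (edges G) x y = G x y.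
Proof.
rewrite /= /edge_set_rel; apply/andP/idP => [[xy /edgesP [a [b [Gab]]]]|Gxy].
  by case/eq_pair=> -[-> ->] //; rewrite edge_sym.
split; first by apply: contraTneq Gxy => ->; rewrite edge_irr.
by apply/edgesP; exists x, y.
Qed.

Definition edge_pairs E := forall e, e \in E -> exists x y, x != y /\ e = [set x; y].

Lemma edges_pairs (G : sgraph V) : edge_pairs (edges G).
Proof.
move=> e /edgesP [x [y [Gxy ->]]]; exists x, y; split=> //.
by apply: contraTneq Gxy => ->; rewrite edge_irr.
Qed.

Lemma edge_pairsS E E' : E' \subset E -> edge_pairs E -> edge_pairs E'.
Proof. by move=> /subsetP sub H e /sub /H. Qed.

(** Passing from edges at v, as two-element sets, to neighbours of v. *)
Lemma big_incident (R : Type) (idx : R) (op : Monoid.com_law idx) E v (F : {set V} -> R) :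
  edge_pairs E ->
  \big[op/idx]_(e in E | v \in e) F e
    = \big[op/idx]_(w | graph_of E v w) F [set v; w].
Proof.
move=> Ep; pose N := [set w | graph_of E v w].
have -> : \big[op/idx]_(e in E | v \in e) F e =
   \big[op/idx]_(e in [set [set v; w] | w in N]) F e.
  apply: eq_bigl => e; apply/andP/imsetP => [[eE ve]|[w wN ->]].
    have [x [y [xy ee]]] := Ep _ eE; subst e.
    move: ve; rewrite !inE => /orP [] /eqP ev; subst v.
      by exists y; rewrite // inE /= /edge_set_rel xy.
    exists x; last by rewrite finset.setUC.
    by rewrite inE /= /edge_set_rel eq_sym xy finset.setUC.
  by move: wN; rewrite !inE eqxx => /andP [_ ->].
rewrite big_imset /=; first by apply: eq_bigl => w; rewrite inE.
move=> w w'; rewrite !inE => /andP [vw _] _ /eq_pair [[]//|[-> <-] //].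
Qed.

Local Open Scope ring_scope.
Variable F : realFieldType.
Implicit Types (g d : {set V} -> F).

(** The weight that g puts on the edges at v. As a function of g, this is the
    incidence map of the graph. *)
Definition load E g v : F := \sum_(e in E | v \in e) g e.

Definition fractional_factor (a b : F) E g : Prop :=
  (forall e, e \in E -> 0 <= g e) /\ (forall v, a <= load E g v <= b).

Lemma sum_load E g (X : {set V}) :
  \sum_(v in X) load E g v = \sum_(e in E) g e * #|X :&: e|%:R.
Proof.
rewrite /load (exchange_big_dep (mem E)) //=; last by move=> v e _ /andP [].
apply: eq_bigr => e eE; rewrite -sum1_card natr_sum mulr_sumr.
by apply: eq_big => [v|v]; rewrite ?inE ?eE // mulr1.
Qed.

Lemma load_support E g E' : E' \subset E ->
  (forall e, e \in E -> e \notin E' -> g e = 0) -> load E' g =1 load E g.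
Proof.
move=> sub z v; rewrite /load [RHS](bigID (mem E')) /= [X in _ + X]big1 ?addr0.
  apply: eq_bigl => e; case: (boolP (e \in E')) => [eE'|]; rewrite ?andbF //=.
  by rewrite (subsetP sub _ eE') andbT.
by move=> e /andP [/andP [eE _] eE']; apply: z.
Qed.

End EdgeSets.

Section Certificate.
Variables (V : finType) (r k : nat).
Local Open Scope ring_scope.

(** Double counting: all edges at the vertices isolated by S end in S, so S
    carries at least their total load. *)
Lemma fractional_factor_isolation (E : {set {set V}}) (F : realFieldType) (g : {set V} -> F) :
  edge_pairs E -> fractional_factor r%:R k%:R E g -> isolation_bound r k (graph_of E).
Proof.
move=> Ep [g0 gb]; apply/forallP => S.
set T := isolated_off _ S; rewrite -(ler_nat F) !natrM.
have h1 : r%:R * #|T|%:R <= \sum_(v in T) load E g v.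
  have -> : r%:R * #|T|%:R = \sum_(v in T) (r%:R : F) by rewrite sumr_const mulr_natr.
  by apply: ler_sum => v _; case/andP: (gb v).
have h2 : \sum_(v in S) load E g v <= k%:R * #|S|%:R.
  have -> : k%:R * #|S|%:R = \sum_(v in S) (k%:R : F) by rewrite sumr_const mulr_natr.
  by apply: ler_sum => v _; case/andP: (gb v).
apply: le_trans h1 (le_trans _ h2); rewrite !sum_load.
apply: ler_sum => e eE; apply: ler_wpM2l; first exact: g0.
rewrite ler_nat.
have [x [y [xy ee]]] := Ep e eE; subst e.
have key u v : u != v -> [set u; v] \in E -> u \in T ->
   (#|T :&: [set u; v]| <= #|S :&: [set u; v]|)%N.
  move=> uv uvE uT; have /isolated_offP [uS uN] := uT.
  have vS : v \in S by apply: uN; rewrite /= /edge_set_rel uv.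
  have -> : T :&: [set u; v] = [set u].
    apply/setP=> w; rewrite !inE; have [->|wu] := eqVneq w u.
      by move: uT; rewrite inE /= => ->.
    by rewrite orFb andbC; have [->|] := eqVneq w v; rewrite // vS.
  rewrite cards1 card_gt0; apply/set0Pn; exists v; by rewrite inE vS set22.
have [xT|xT] := boolP (x \in T); first exact: key.
have [yT|yT] := boolP (y \in T).
  by rewrite finset.setUC; apply: key => //; rewrite 1?eq_sym // finset.setUC.
have -> : T :&: [set x; y] = finset.set0; last by rewrite cards0.
apply/setP=> w; rewrite !inE -/T.
apply/negbTE; apply: contra xT.
case/andP => wT /orP [] /eqP ew; subst w; first by rewrite inE.
by rewrite inE wT in yT.
Qed.

(** Averaging a balanced flow with its reverse turns the bounds on outflow and
    inflow into the same bounds on the load. *)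
Lemma isolation_fractional_factor (E : {set {set V}}) (F : realFieldType) :
  edge_pairs E -> (r <= k)%N -> isolation_bound r k (graph_of E) ->
  exists g : {set V} -> F, fractional_factor r%:R k%:R E g.
Proof.
move=> Ep rk /(balanced_flow rk) [h [sup row col]].
(* on the edge xy the double sum is h x y + h y x *)
exists (fun e : {set V} => (\sum_(x in e) \sum_(y in e) h x y)%N%:R / 2); split.
  by move=> e _; rewrite divr_ge0.
move=> v.
have -> : load E (fun e : {set V} => (\sum_(x in e) \sum_(y in e) h x y)%N%:R / 2 : F) v
   = (outflow h v + inflow h v)%N%:R / 2.
  have h0 u w : ~~ graph_of E u w -> h u w = 0%N.
    by move=> nuw; apply/eqP; rewrite -leqn0 leqNgt; apply: contra nuw => /sup.
  rewrite /load big_incident //.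
  have -> : (outflow h v + inflow h v)%N = (\sum_(w | graph_of E v w) (h v w + h w v))%N.
    rewrite big_split /=; congr addn.
      rewrite /outflow (bigID (graph_of E v)) /= [X in (_ + X)%N]big1 ?addn0 // => w; exact: h0.
    rewrite /inflow (bigID (graph_of E v)) /= [X in (_ + X)%N]big1 ?addn0 // => w nvw.
    by apply: h0; rewrite edge_sym.
  rewrite natr_sum mulr_suml; apply: eq_bigr => w /andP [vw _].
  have hh u : h u u = 0%N by apply: h0; rewrite edge_irr.
  congr (_%:R / _); rewrite !big_setU1 ?inE ?big_set1 //=.
  by rewrite !big_setU1 ?inE ?big_set1 //= !hh addn0 add0n.
have /andP [] := row v; have /andP [] := col v.
rewrite -!(ler_nat F) natrD; lra.
Qed.

End Certificate.

(** * Edge-minimal graphs *)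

(** In an edge-minimal graph every fractional factor is positive on all edges, so
    no modification of its weights that keeps the loads within their bounds can
    make an edge vanish. The lemmas of this section draw consequences from this
    about the incidence map [load E]. *)
Section Minimal.
Variables (V : finType) (r k : nat) (E : {set {set V}}).
Hypothesis r_gt0 : 0 < r.
Hypothesis le_rk : r <= k.
Hypothesis E_pairs : edge_pairs E.
Hypothesis E_bound : isolation_bound r k (graph_of E).
Hypothesis E_min : forall e, e \in E -> ~~ isolation_bound r k (graph_of (E :\ e)).

Local Notation H := (graph_of E).
Local Open Scope ring_scope.
Implicit Types (g d : {set V} -> rat) (v x y : V) (e : {set V}).
Local Notation factor := (fractional_factor (r%:R : rat) k%:R E).

Lemma factor_neq0 g e : factor g -> e \in E -> g e != 0.
Proof.
move=> [g0 gb] eE; apply/negP => /eqP ge0.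
have := E_min eE; apply/negP/negPn.
apply: (@fractional_factor_isolation _ _ _ _ _ g).
  exact: edge_pairsS (subsetDl _ _) E_pairs.
split=> [e'|v]; first by case/setD1P => _; apply: g0.
rewrite (load_support (E := E)) ?subsetDl // => e' e'E.
by rewrite !inE e'E andbT negbK => /eqP ->.
Qed.

Lemma load_lin g d t v : load E (fun e => g e + t * d e) v = load E g v + t * load E d v.
Proof. by rewrite /load mulr_sumr -big_split. Qed.

(** Otherwise follow d until the first edge vanishes. *)
Lemma no_descent g d : factor g ->
  (forall t, 0 <= t -> (forall e, e \in E -> 0 <= g e + t * d e) ->
     forall v, r%:R <= load E (fun e => g e + t * d e) v <= k%:R) ->
  forall e, e \in E -> 0 <= d e.
Proof.
move=> gf feas e0 e0E; rewrite leNgt; apply/negP => d0.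
have [g0 _] := gf.
pose P e := (e \in E) && (d e < 0).
have P0 : P e0 by rewrite /P e0E.
case: (@Order.TotalTheory.arg_minP _ _ _ e0 P (fun e => g e / - d e) P0).
move=> e1 /andP [e1E d1] emin.
(* the largest step that keeps all weights nonnegative; it makes e1 vanish *)
pose t := g e1 / - d e1.
have t0 : 0 <= t by rewrite divr_ge0 ?g0 // oppr_ge0 ltW.
have nn e : e \in E -> 0 <= g e + t * d e.
  move=> eE; have [de|de] := ltP (d e) 0; last by apply: addr_ge0; [exact: g0 | exact: mulr_ge0].
  have := emin e; rewrite /P eE de => /(_ isT); rewrite -/t.
  rewrite ler_pdivlMr ?oppr_gt0 //; lra.
have : g e1 + t * d e1 != 0.
  by apply: (factor_neq0 (g := fun e => g e + t * d e)) => //; split => //; apply: feas.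
by rewrite /t invrN mulrN mulNr divfK ?subrr ?eqxx // lt_eqF.
Qed.

Lemma factor_exists : exists g, factor g.
Proof. exact: isolation_fractional_factor. Qed.

(** Both d and its opposite preserve all loads. *)
Lemma load_kernel0 d : (forall v, load E d v = 0) -> forall e, e \in E -> d e = 0.
Proof.
move=> d0 e eE; have [g gf] := factor_exists; have [_ gb] := gf.
apply/eqP; rewrite eq_le; apply/andP; split.
  rewrite -oppr_ge0; apply: (no_descent (d := fun e => - d e) gf) eE => t _ _ v.
  rewrite load_lin; have -> : load E (fun e => - d e) v = 0; last by rewrite mulr0 addr0.
  by rewrite /load sumrN -/(load E d v) d0 oppr0.
by apply: (no_descent (d := d) gf) eE => t _ _ v; rewrite load_lin d0 mulr0 addr0.
Qed.

Definition deg v := #|[set e in E | v \in e]|.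

Lemma deg_gt0 v : (0 < deg v)%N.
Proof.
have [g [_ gb]] := factor_exists.
rewrite lt0n; apply/eqP => /eqP; rewrite cards_eq0 => /eqP d0.
have := gb v; rewrite /load big1 => [|e]; last first.
  by move=> /andP [eE ve]; move/setP: d0 => /(_ e); rewrite !inE eE ve.
by rewrite lern0 -leqn0 leqNgt r_gt0.
Qed.

(** If the load of a leaf v could be changed alone, it could be increased until
    an edge vanishes: the load of v never exceeds that of its neighbour, which
    stays at most k. *)
Lemma deg_neq1 v d : (forall w, load E d w = (w == v)%:R) -> deg v != 1%N.
Proof.
move=> dv; apply/negP => /cards1P [e0 e0P].
have inc e : (e \in E) && (v \in e) = (e == e0).
  by move/setP: e0P => /(_ e); rewrite !inE.
have ld g : load E g v = g e0.
  by rewrite /load (eq_bigl (pred1 e0)) ?big_pred1_eq // => e; rewrite inc.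
have /andP [e0E ve0] : (e0 \in E) && (v \in e0) by rewrite inc.
have [u [uv e0u]] : exists u, u != v /\ u \in e0.
  have [x [y [xy e]]] := E_pairs e0E; subst e0.
  move: ve0; rewrite !inE => /orP [] /eqP ev; subst v.
    by exists y; rewrite eq_sym xy set22.
  by exists x; rewrite xy set21.
have up g : (forall e, e \in E -> 0 <= g e) -> g e0 <= load E g u.
  move=> g0; rewrite /load (bigD1 e0) ?e0E //= lerDl sumr_ge0 // => e /andP [/andP [eE _] _].
  exact: g0.
have [g gf] := factor_exists; have [g0 gb] := gf.
(* moving along d only raises the load of v, which is the weight of e0 and hence
   at most the load of u *)
have d0 : forall e, e \in E -> 0 <= d e.
  apply: (no_descent gf) => t t0 nn w.
  have [->|wv] := eqVneq w v.
    apply/andP; split.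
      rewrite load_lin dv eqxx mulr1; case/andP: (gb v) => h _.
      by apply: le_trans h _; rewrite lerDl.
    rewrite ld; apply: le_trans (up (fun e => g e + t * d e) nn) _.
    by rewrite load_lin dv (negPf uv) mulr0 addr0; case/andP: (gb u).
  by rewrite load_lin dv (negPf wv) mulr0 addr0.
by have := up d d0; rewrite -(ld d) !dv (negPf uv) eqxx ler10.
Qed.

Lemma load_edge x y v : H x y ->
  load E (fun e => (e == [set x; y])%:R) v = (v == x)%:R + (v == y)%:R :> rat.
Proof.
move=> /andP [xy xyE]; rewrite /load.
have [vxy|vxy] := boolP (v \in [set x; y]).
  rewrite (bigD1 [set x; y]) ?xyE //= eqxx big1 ?addr0.
    move: vxy; rewrite !inE => /orP [] /eqP ->; rewrite eqxx ?(negPf xy) ?addr0 //.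
    by rewrite eq_sym (negPf xy) add0r.
  by move=> e /andP [_ /negPf ->].
rewrite big1.
  by move: vxy; rewrite !inE negb_or => /andP [/negPf -> /negPf ->]; rewrite addr0.
move=> e /andP [_ ve]; have [ee|//] := eqVneq e [set x; y].
by rewrite ee (negPf vxy) in ve.
Qed.

(** The edge xz has load 1 at both ends, so subtracting a preimage of the
    indicator of x gives one for z. *)
Lemma load_span_connect x y d : connect H x y ->
  (forall w, load E d w = (w == x)%:R) ->
  exists d', forall w, load E d' w = (w == y)%:R.
Proof.
case/connectP => p; elim: p x d => [|z p IH] x d /=.
  by move=> _ -> dx; exists d.
case/andP=> xz pth lst dx.
apply: (IH z (fun e => (e == [set x; z])%:R + (-1) * d e)) => // w.
by rewrite load_lin load_edge // dx; lra.
Qed.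

(** Injectivity of the incidence map bounds the number of edges by the number of
    vertices. *)
Lemma component_edges_le (C : {set V}) : closed H (mem C) ->
  (#|[set e in E | e \subset C]| <= #|C|)%N.
Proof.
move=> clC; set EC := [set e in E | _].
rewrite leqNgt; apply/negP => lt.
(* the incidence matrix of the component; with more rows than columns its left
   kernel is nonzero *)
pose A : 'M[rat]_(#|EC|, #|C|) := \matrix_(i < #|EC|, j < #|C|) ((enum_val j : V) \in (enum_val i : {set V}))%:R.
have kA : kermx A != 0.
  by rewrite -mxrank_eq0 mxrank_ker -lt0n subn_gt0 (leq_ltn_trans (rank_leq_col A)).
have [i ri] : exists i, row i (kermx A) != 0.
  apply/existsP; apply: contraR kA; rewrite negb_exists => /forallP z.
  by apply/eqP/row_matrixP => i; have := z i; rewrite negbK row0 => /eqP.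
pose y := row i (kermx A).
have yA : y *m A = 0 by apply/sub_kermxP; apply: row_sub.
pose d e : rat := \sum_j y 0 j * (e == enum_val j)%:R.
have dval j : d (enum_val j) = y 0 j.
  rewrite /d (bigD1 j) //= eqxx mulr1 big1 ?addr0 // => j' nj.
  by rewrite (inj_eq enum_val_inj) eq_sym (negPf nj) mulr0.
have dout e : e \notin EC -> d e = 0.
  move=> eEC; rewrite /d big1 // => j _; case: eqP => [ee|]; last by rewrite mulr0.
  by rewrite ee enum_valP in eEC.
have sub : EC \subset E by apply/subsetP => e; rewrite inE => /andP [].
have dE : forall e, e \in E -> d e = 0.
  apply: load_kernel0 => v.
  rewrite -(@load_support _ _ E d EC) //; last by move=> e _; apply: dout.
  have [vC|vC] := boolP (v \in C); last first.
    rewrite /load big1 // => e /andP []; rewrite inE => /andP [_ /subsetP eC] /eC.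
    by rewrite (negPf vC).
  rewrite /load.
  have := congr1 (fun M : 'rV__ => M 0 (enum_rank_in vC v)) yA.
  rewrite !mxE => y0; rewrite -[RHS]y0 big_mkcondr /= big_enum_val /=.
  apply: eq_bigr => j _; rewrite dval !mxE enum_rankK_in //.
  by case: (v \in _); rewrite ?mulr1 ?mulr0.
move: ri; rewrite -/y => /eqP; apply; apply/rowP => j.
by rewrite [RHS]mxE -dval dE // (subsetP sub) // enum_valP.
Qed.

Lemma incident_component (C : {set V}) e v : closed H (mem C) -> e \in E -> v \in e ->
  v \in C -> e \subset C.
Proof.
move=> clC eE; have [x [y [xy ee]]] := E_pairs eE; subst e.
have xyH : H x y by rewrite /= /edge_set_rel xy.
have cl : (x \in C) = (y \in C) := clC _ _ xyH.
rewrite !inE => /orP [] /eqP -> vC; apply/subsetP => w; rewrite !inE => /orP [] /eqP -> //.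
  by rewrite -cl.
by rewrite cl.
Qed.

Lemma deg_sum_le (C : {set V}) : closed H (mem C) ->
  (\sum_(v in C) deg v <= 2 * #|C|)%N.
Proof.
move=> clC; apply: leq_trans (leq_mul (leqnn 2) (component_edges_le clC)).
rewrite (eq_bigr (fun v => \sum_(e in E | v \in e) 1)%N); last first.
  by move=> v _; rewrite /deg -sum1_card; apply: eq_bigl => e; rewrite inE.
rewrite (exchange_big_dep (mem [set e in E | e \subset C])) /=; last first.
  move=> v e vC /andP [eE ve]; rewrite inE eE; exact: (incident_component clC eE ve vC).
rewrite mulnC -sum_nat_const; apply: leq_sum => e.
rewrite inE => /andP [eE _]; rewrite sum1_card.
have [x [y [xy ee]]] := E_pairs eE.
have <- : #|e| = 2%N by rewrite ee cards2 xy.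
by apply: subset_leq_card; apply/subsetP => v; rewrite -topredE /= => /and3P [].
Qed.

(** Under the hypothesis on d the incidence map is also onto the functions on the
    component of x. Hence there is no leaf, all degrees are at least 2, and they
    add up to twice the number of edges, which is at most [2 |C|]. *)
Lemma deg_eq2 x (C := component H x) d :
  (forall w, load E d w = (w == x)%:R) -> forall v, v \in C -> deg v = 2%N.
Proof.
move=> dx.
have clC : closed H (mem C) by apply: component_closed.
have ge2 v : v \in C -> (2 <= deg v)%N.
  rewrite inE => xv; have [d' dv] := load_span_connect xv dx.
  by have := deg_neq1 dv; have := deg_gt0 v; case: (deg v) => [|[]].
move=> v vC; apply/eqP; rewrite eqn_leq ge2 // andbT.
have := deg_sum_le clC; rewrite (bigD1 v) //=.
have : (\sum_(i in C | i != v) 2 <= \sum_(i in C | i != v) deg i)%N.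
  by apply: leq_sum => i /andP [iC _]; apply: ge2.
have -> : (2 * #|C| = 2 + \sum_(i in C | i != v) 2)%N.
  by rewrite mulnC -sum_nat_const (bigD1 v).
lia.
Qed.

End Minimal.

(** * Cycles in an edge-minimal graph *)

Section Cycle.
Variables (V : finType) (E : {set {set V}}) (c : seq V) (x0 : V).
Local Notation H := (graph_of E).
Local Notation m := (size c).
Hypothesis c_cycle : ucycle H c.
Hypothesis m_gt2 : 2 < m.

(** Indices are read modulo the length, so that [cyc_edge] needs no case for the
    closing edge. *)
Definition cyc i := nth x0 c (i %% m).
Definition cyc_edge i := [set cyc i; cyc i.+1].

Let m_gt0 : 0 < m. Proof. exact: leq_trans m_gt2. Qed.

Lemma cyc_mem i : cyc i \in c.
Proof. by rewrite mem_nth // ltn_pmod. Qed.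

Lemma cyc_index v : v \in c -> cyc (index v c) = v.
Proof. by move=> vc; rewrite /cyc modn_small ?index_mem // nth_index. Qed.

Lemma cyc_inj i j : cyc i = cyc j -> i = j %[mod m].
Proof.
case/andP: c_cycle => _ unq /eqP.
by rewrite /cyc nth_uniq ?ltn_pmod // => /eqP.
Qed.

Lemma cyc_adj i : H (cyc i) (cyc i.+1).
Proof.
case/andP: c_cycle => + _; rewrite /cyc -addn1 -modnDml.
have := ltn_pmod i m_gt0; move: (i %% m) => {}i.
case: (c) => //= x p lt /(pathP x0).
rewrite size_rcons => /(_ i lt); rewrite -rcons_cons nth_rcons /= lt nth_rcons.
congr (edge_set_rel _ _ _); rewrite addn1.
move: lt; rewrite ltnS leq_eqVlt => /orP [/eqP ->|lt].
  by rewrite ltnn eqxx modnn.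
by rewrite lt modn_small.
Qed.

Lemma cyc_edge_in i : cyc_edge i \in E.
Proof. by case/andP: (cyc_adj i). Qed.

(** This is where length at least 3 matters: in a closed walk of length 2 both
    edges coincide. *)
Lemma cyc_edge_inj i j : cyc_edge i = cyc_edge j -> i = j %[mod m].
Proof.
case/eq_pair => -[/cyc_inj h1 /cyc_inj h2] //.
have : j.+2 = j %[mod m] by rewrite -h2 -[i.+1]addn1 -[j.+2]addn1 -modnDml -h1 modnDml.
rewrite -addn2 -[in RHS](addn0 j) => /eqP; rewrite eqn_modDl modn_small // mod0n.
by [].
Qed.

Local Open Scope ring_scope.

Definition cyc_weight (w : nat -> rat) (e : {set V}) : rat :=
  \sum_(j < m) w j * (e == cyc_edge j)%:R.

Lemma cyc_weightE w p : (p < m)%N -> cyc_weight w (cyc_edge p) = w p.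
Proof.
move=> pm; rewrite /cyc_weight (bigD1 (Ordinal pm)) //= eqxx mulr1 big1 ?addr0 // => j /eqP ne.
case: eqP => [/cyc_edge_inj|]; last by rewrite mulr0.
by rewrite !modn_small // => e; case: ne; apply: val_inj.
Qed.

Lemma load_cyc_weight w v : load E (cyc_weight w) v =
  \sum_(j < m) w j * ((v == cyc j)%:R + (v == cyc j.+1)%:R).
Proof.
rewrite /load exchange_big /=; apply: eq_bigr => j _.
by rewrite -mulr_sumr; congr (_ * _); apply: load_edge; apply: cyc_adj.
Qed.

Lemma load_cyc_out w v : v \notin c -> load E (cyc_weight w) v = 0.
Proof.
move=> vc; rewrite load_cyc_weight big1 // => j _.
have ne i : v == cyc i = false by apply: contraNF vc => /eqP ->; apply: cyc_mem.
by rewrite !ne addr0 mulr0.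
Qed.

Lemma load_cyc w p : (p < m)%N ->
  load E (cyc_weight w) (cyc p) = w p + w (if p == 0%N then m.-1 else p.-1).
Proof.
move=> pm; rewrite load_cyc_weight.
under eq_bigr do rewrite mulrDr.
rewrite big_split /=; congr (_ + _).
  rewrite (bigD1 (Ordinal pm)) //= eqxx mulr1 big1 ?addr0 // => j /eqP ne.
  case: eqP => [/cyc_inj|]; last by rewrite mulr0.
  by rewrite !modn_small // => e; case: ne; apply: val_inj.
set q := if _ then _ else _.
have qm : (q < m)%N by rewrite /q; case: eqP => _; [rewrite prednK | apply: leq_ltn_trans pm; apply: leq_pred].
have pq : (p = q.+1 %% m)%N.
  rewrite /q; case: eqP => [->|/eqP p0]; first by rewrite prednK // modnn.
  by rewrite prednK ?lt0n // modn_small.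
rewrite (bigD1 (Ordinal qm)) //=.
have -> : cyc p == cyc q.+1 by rewrite pq /cyc modn_mod.
rewrite mulr1 big1 ?addr0 // => j /eqP ne.
case: eqP => [/cyc_inj|]; last by rewrite mulr0.
rewrite (modn_small pm) pq -[q.+1]addn1 -[j.+1]addn1 => /eqP; rewrite eqn_modDr !modn_small //.
by move=> /eqP e; case: ne; apply: val_inj.
Qed.

End Cycle.

Section MinimalCycle.
Variables (V : finType) (r k : nat) (E : {set {set V}}).
Hypothesis r_gt0 : 0 < r.
Hypothesis lt_rk : r < k.
Hypothesis E_pairs : edge_pairs E.
Hypothesis E_bound : isolation_bound r k (graph_of E).
Hypothesis E_min : forall e, e \in E -> ~~ isolation_bound r k (graph_of (E :\ e)).
Let le_rk := ltnW lt_rk.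

Local Notation H := (graph_of E).
Variables (c : seq V) (x0 : V).
Hypothesis c_cycle : ucycle H c.
Local Notation m := (size c).
Hypothesis m_gt2 : 2 < m.
Local Notation cy := (cyc c x0).
Local Notation cye := (cyc_edge c x0).
Local Notation cyw := (cyc_weight c x0).

Local Open Scope ring_scope.

(** Alternating signs cancel at every vertex except the starting one, where the
    two signs agree exactly when the length is odd. *)
Lemma load_alternating v :
  load E (cyw (fun j => (-1) ^+ j)) v = (2 * odd m * (v == cy 0))%:R.
Proof.
have [vc|vc] := boolP (v \in c); last first.
  rewrite load_cyc_out //; case: eqP => [ev|]; last by rewrite muln0.
  by rewrite ev cyc_mem // in vc.
rewrite -(cyc_index x0 vc); have := vc; rewrite -index_mem; move: (index v c) => p pm.
rewrite load_cyc //; have [->|p0] := eqVneq p 0%N.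
  rewrite expr0 eqxx -signr_odd; have -> : odd m.-1 = ~~ odd m by lia.
  by case: (odd m) => /=; rewrite ?expr0 // expr1 subrr.
have -> : cy p == cy 0 = false.
  by apply/negP => /eqP /(cyc_inj c_cycle m_gt2); rewrite modn_small // mod0n; apply/eqP.
by rewrite muln0; case: p p0 pm => //= p _ _; rewrite exprS mulN1r addrC subrr.
Qed.

(** Alternating signs on an even cycle would lie in the kernel of [load E]. *)
Lemma cycle_odd : odd m.
Proof.
apply/negPn/negP => /negbTE even.
have d0 v : load E (cyw (fun j => (-1) ^+ j)) v = 0.
  by rewrite load_alternating even muln0 mul0n.
have /eqP := load_kernel0 le_rk E_pairs E_bound E_min d0 (cyc_edge_in x0 c_cycle m_gt2 0).
by rewrite (cyc_weightE _ c_cycle m_gt2) // ?expr0 ?oner_eq0 // (leq_trans _ m_gt2).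
Qed.

Let C := component H (cy 0).

(** Half of the alternating weights is a preimage of the indicator of one
    vertex. *)
Lemma cycle_deg v : v \in C -> deg E v = 2%N.
Proof.
apply: (deg_eq2 r_gt0 le_rk E_pairs E_bound E_min
  (d := fun e => 2^-1 * cyw (fun j => (-1) ^+ j) e)) => w.
have -> : load E (fun e => 2^-1 * cyw (fun j => (-1) ^+ j) e) w =
  2^-1 * load E (cyw (fun j => (-1) ^+ j)) w by rewrite /load mulr_sumr.
by rewrite load_alternating cycle_odd muln1 mulnC natrM mulrCA mulVf // mulr1.
Qed.

Lemma cyc_prev p : cy (p + m.-1).+1 = cy p.
Proof.
by rewrite -addnS prednK ?(leq_trans _ m_gt2) // /cyc modnDr.
Qed.

Lemma connect_cyc p : connect H (cy 0) (cy p).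
Proof.
elim: p => // p /connect_trans; apply; apply: connect1; exact: cyc_adj.
Qed.

Lemma cyc_nbr p y : H (cy p) y -> y = cy p.+1 \/ y = cy (p + m.-1).
Proof.
move=> py; have pC : cy p \in C by rewrite inE; exact: connect_cyc.
have ne : cye p != cye (p + m.-1).
  apply/negP => /eqP /(cyc_edge_inj c_cycle m_gt2) => /eqP.
  by rewrite -[X in X == _ %[mod _]]addn0 eqn_modDl mod0n modn_small; lia.
have sub : [set cye p; cye (p + m.-1)] \subset [set e in E | cy p \in e].
  apply/subsetP => e; rewrite !inE => /orP [] /eqP ->; rewrite cyc_edge_in //=.
    by rewrite set21.
  by rewrite /cyc_edge cyc_prev set22.
have /eqP eqS : [set cye p; cye (p + m.-1)] == [set e in E | cy p \in e].
  by rewrite eqEcard sub cards2 ne -/(deg E _) cycle_deg.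
have : [set cy p; y] \in [set e in E | cy p \in e].
  by case/andP: py => _ h; rewrite inE h set21.
rewrite -eqS !inE => /orP [] /eqP /eq_pair; rewrite ?cyc_prev.
  by case=> -[h1 h2]; auto; left; rewrite h2 -h1.
by case=> -[h1 h2]; auto; right; rewrite h2 -h1.
Qed.

(** All degrees being 2, no edge leaves the cycle. *)
Lemma cycle_component v : (v \in C) = (v \in c).
Proof.
apply/idP/idP => [|vc]; last by rewrite inE -(cyc_index x0 vc); exact: connect_cyc.
rewrite inE => /connectP [p pth ->].
have := cyc_mem x0 m_gt2 0; elim: p (cy 0) pth => //= y p IH x /andP [xy pth] xc.
apply: IH => //; move: xy; rewrite -(cyc_index x0 xc) => /cyc_nbr [] ->; exact: cyc_mem.
Qed.

Lemma cycle_adjE x y : x \in c -> y \in c ->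
  H x y = ((index x c).+1 %% m == index y c)%N || ((index y c).+1 %% m == index x c)%N.
Proof.
move=> xc yc.
have ix : (index x c < m)%N by rewrite index_mem.
have iy : (index y c < m)%N by rewrite index_mem.
have next u v : u \in c -> v \in c -> ((index u c).+1 %% m == index v c)%N -> H u v.
  move=> uc vc /eqP e; rewrite -(cyc_index x0 uc) -[v](cyc_index x0 vc) -e.
  have := cyc_adj x0 c_cycle m_gt2 (index u c).
  by rewrite /cyc !modn_mod.
apply/idP/orP; last first.
  by case=> h; [apply: next | rewrite edge_sym; apply: next].
rewrite -{1}(cyc_index x0 xc) -{1}(cyc_index x0 yc) => /cyc_nbr [] /(cyc_inj c_cycle m_gt2).
  by move=> e; left; rewrite -e modn_small.
move=> e; right.
have : ((index y c).+1 = index x c %[mod m])%N.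
  rewrite -addn1 -modnDml e modnDml -addnA addn1 prednK ?modnDr //.
  exact: leq_trans m_gt2.
by rewrite [RHS]modn_small // => ->.
Qed.

Lemma component_circuit : graph_iso (induced H C) (circuit m).
Proof.
have inc (x : {x : V | x \in C}) : val x \in c by rewrite -cycle_component; apply: valP.
have idx (x : {x : V | x \in C}) : (index (val x) c < m)%N by rewrite index_mem.
exists (fun x => Ordinal (idx x)).
  apply: inj_card_bij.
    move=> x y /(congr1 val) /= e; apply: val_inj.
    by rewrite -(cyc_index x0 (inc x)) e (cyc_index x0 (inc y)).
  case/andP: c_cycle => _ unq.
  rewrite card_ord card_sig -(card_uniqP unq) -(eq_card (cycle_component)).
  by apply: eq_leq; apply: eq_card => v; rewrite -[RHS]topredE.
move=> x y; rewrite /= /circuit_edge /induced_edge [RHS]cycle_adjE; [|exact: inc|exact: inc].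
rewrite -!(inj_eq val_inj) /=.
set i := index _ _; set j := index _ _.
case: eqP => //= ij; rewrite ij; apply/esym/negbTE.
rewrite orbb; have jm : (j < m)%N by rewrite index_mem; exact: inc.
apply/eqP => e; have := e; have [lt|ge] := ltnP j.+1 m; first by rewrite modn_small //; lia.
have -> : j.+1 = m by lia.
rewrite modnn; lia.
Qed.

(** If [r <= i (k - r)], the path obtained by deleting one edge of the cycle has a
    fractional factor of its own, against minimality. *)
Lemma cycle_length i : m = (2 * i + 1)%N -> i%:R < r%:R / (k%:R - r%:R) :> rat.
Proof.
move=> mi.
have kr : 0 < (k%:R - r%:R : rat) by rewrite subr_gt0 ltr_nat.
have i0 : (0 < i)%N by move: m_gt2; rewrite mi; lia.
have iR : 0 < (i%:R : rat) by rewrite ltr0n.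
have rR : 0 < (r%:R : rat) by rewrite ltr0n.
rewrite ltNge ler_pdivrMr //; apply/negP => le.
have i2 : 2 * i%:R != 0 :> rat by rewrite mulf_neq0 ?lt0r_neq0.
have i1 : i%:R != 0 :> rat by rewrite lt0r_neq0.
have [g [g0 gb]] := factor_exists le_rk E_pairs E_bound.
have mgt := ltnW (ltnW m_gt2).
(* on the path c_0 ... c_2i these weights give load r at the even vertices and
   r (i + 1) / i at the odd ones; the closing edge c_2i c_0 gets weight 0 *)
pose w j : rat := if odd j then r%:R * (j.+1)%:R / (2 * i%:R)
                  else r%:R * (2 * i%:R - j%:R) / (2 * i%:R).
pose g' e := cyw w e + (if e \subset C then 0 else g e).
have w_ge0 j : (j < m)%N -> 0 <= w j.
  move=> jm; rewrite /w; case: ifP => _; apply: divr_ge0; rewrite ?mulr_ge0 //; try lra.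
  by rewrite subr_ge0 -natrM ler_nat; lia.
have wlast : w (m.-1) = 0.
  by rewrite /w mi addn1 /= mul2n odd_double -mul2n natrM subrr mulr0 mul0r.
have clC : closed H (mem C) by apply: component_closed.
have loadg' v : load E g' v = if v \in C then load E (cyw w) v else load E g v.
  have -> : load E g' v = load E (cyw w) v
      + load E (fun e => if e \subset C then 0 else g e) v by rewrite /load big_split.
  case: ifP => vC.
    rewrite [X in _ + X]/load big1 ?addr0 // => e /andP [eE ve].
    by rewrite (incident_component E_pairs clC eE ve vC).
  rewrite load_cyc_out // -?cycle_component ?vC // add0r; apply: eq_bigr => e /andP [eE ve].
  by case: ifP => // /subsetP /(_ _ ve); rewrite vC.
have wsum p : (p < m)%N -> r%:R <= w p + w (if p == 0%N then m.-1 else p.-1) <= k%:R.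
  move=> pm; have [->|p0] := eqVneq p 0%N.
    by rewrite wlast addr0 /w /= subr0 mulfK // lexx ler_nat.
  case: p p0 pm => //= p _ pm; rewrite /w /=.
  case: (odd p) => /=.
    have -> : (r%:R : rat) * (2 * i%:R - p.+1%:R) / (2 * i%:R) + r%:R * p.+1%:R / (2 * i%:R)
       = r%:R by field.
    by rewrite lexx ler_nat.
  have -> : (r%:R : rat) * p.+2%:R / (2 * i%:R) + r%:R * (2 * i%:R - p%:R) / (2 * i%:R)
     = r%:R + r%:R / i%:R by rewrite -addn2 natrD; field.
  rewrite lerDl divr_ge0 //=.
  have : r%:R / i%:R <= k%:R - r%:R :> rat by rewrite ler_pdivrMr // mulrC.
  lra.
have eE : cye m.-1 \in E by apply: cyc_edge_in.
have := E_min eE; apply/negP/negPn.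
apply: (fractional_factor_isolation (g := g')).
  exact: edge_pairsS (subsetDl _ _) E_pairs.
split=> [e /setD1P [_ eE']|v].
  rewrite addr_ge0 //; last by case: ifP => // _; apply: g0.
  by apply: sumr_ge0 => j _; rewrite mulr_ge0 ?w_ge0.
rewrite (load_support (E := E)) ?subsetDl //; last first.
  move=> e eE'; rewrite !inE eE' andbT negbK => /eqP ->.
  rewrite /g' (cyc_weightE _ c_cycle m_gt2) ?prednK // wlast add0r.
  rewrite (incident_component E_pairs clC eE (set21 _ _)) // inE; exact: connect_cyc.
rewrite loadg'; case: ifP => [|_]; last exact: gb.
rewrite cycle_component => vc; rewrite -(cyc_index x0 vc) load_cyc //; last by rewrite index_mem.
by apply: wsum; rewrite index_mem.
Qed.

End MinimalCycle.

(** * The factor theorem *)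

Lemma eq_isolation_bound r k (V : finType) (G G' : sgraph V) : G =2 G' ->
  isolation_bound r k G = isolation_bound r k G'.
Proof.
move=> e; apply: eq_forallb => S; congr (r * _ <= _); apply: eq_card => x.
rewrite !inE; congr (_ && _); by apply: eq_forallb => y; rewrite e.
Qed.

(** T is an induced subgraph of G given only pointwise, so that the lemma applies
    both to a component and to a component with one edge deleted. *)
Lemma card_isolated_induced (V : finType) (G : sgraph V) (C : {set V})
    (T : sgraph {x : V | x \in C}) (S : {set V}) :
  (forall x y, T x y = G (val x) (val y)) -> closed G (mem C) ->
  #|isolated_off T (val @^-1: S)| = #|isolated_off G S :&: C|.
Proof.
move=> TG clC; rewrite -(card_imset _ val_inj); apply: eq_card => v.
rewrite [RHS]inE; apply/imsetP/andP => [[u /isolated_offP [uS uN] ->]|[/isolated_offP [vS vN] vC]].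
  split; last exact: valP.
  apply/isolated_offP; split; first by rewrite inE in uS.
  move=> w uw; have wC : w \in C by have := clC _ _ uw; rewrite /= => <-; apply: valP.
  by have := uN (Sub w wC); rewrite TG inE; apply.
exists (Sub v vC) => //; apply/isolated_offP; split; first by rewrite inE.
by move=> w; rewrite TG inE; apply: vN.
Qed.

Lemma card_preim_val (V : finType) (C S : {set V}) :
  #|(val : {x : V | x \in C} -> V) @^-1: S| = #|S :&: C|.
Proof.
rewrite -(card_imset _ val_inj); apply: eq_card => v; rewrite [RHS]inE.
apply/imsetP/andP => [[u uS ->]|[vS vC]].
  by split; [rewrite inE in uS | apply: valP].
by exists (Sub v vC); rewrite // inE.
Qed.

(** Both conditions pass from the whole graph to the component C. For the second,
    a set violating the bound after deleting an edge of C violates it inside C,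
    since outside C nothing has changed. *)
Lemma tree_component (r k : nat) (V : finType) (E : {set {set V}}) x :
  0 < r -> isolation_bound r k (graph_of E) ->
  (forall e, e \in E -> ~~ isolation_bound r k (graph_of (E :\ e))) ->
  acyclic_graph (induced (graph_of E) (component (graph_of E) x)) ->
  tree_class k r (induced (graph_of E) (component (graph_of E) x)).
Proof.
move=> r0 ok mini acy; set H := graph_of E; set C := component H x.
have rR : (0 < r%:R :> rat)%R by rewrite ltr0n.
have clC : closed H (mem C) by apply: component_closed.
split; first by split=> //; apply: component_connected.
  move=> S; rewrite num_isolated_del mulrAC ler_pdivlMr // -!natrM ler_nat mulnC.
  have -> : S = val @^-1: (val @: S).
    by apply/setP => u; rewrite inE mem_imset //; apply: val_inj.
  rewrite (card_isolated_induced (G := H)) // card_preim_val.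
  have sub : val @: S \subset C by apply/subsetP => _ /imsetP [u _ ->]; apply: valP.
  rewrite (setIidPl sub); move/forallP: ok => /(_ (val @: S)); apply: leq_trans.
  by rewrite leq_mul2l subset_leq_card ?orbT // subsetIl.
move=> u v uv; set e := [set val u; val v].
have /andP [uvne eE] : H (val u) (val v) by [].
have /forallPn [S0 S0n] := mini _ eE.
exists (val @^-1: S0); rewrite num_isolated_del mulrAC ltr_pdivrMr // -!natrM ltr_nat.
have adjE (a b : V) : graph_of (E :\ e) a b = H a b && ([set a; b] != e).
  by rewrite /= /edge_set_rel !inE; case: (a == b) => //=; rewrite andbC.
have clC' : closed (graph_of (E :\ e)) (mem C).
  by move=> a b; rewrite adjE => /andP [ab _]; apply: clC.
have TE (a b : {x : V | x \in C}) :
    del_edge (induced H C) u v a b = graph_of (E :\ e) (val a) (val b).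
  rewrite adjE /= /del_edge_rel /= /induced_edge /=; congr (_ && ~~ _).
  rewrite /e; apply/eqP/eqP => [|h]; first by case/eq_pair=> -[-> ->]; rewrite // finset.setUC.
  by case/eq_pair: h => -[/val_inj -> /val_inj ->]; rewrite // finset.setUC.
rewrite (card_isolated_induced _ TE clC') card_preim_val [X in _ < X]mulnC.
move: S0n; rewrite -ltnNge -/e.
rewrite -(cardsID C (isolated_off _ S0)) -(cardsID C S0) !mulnDr.
have out : r * #|isolated_off (graph_of (E :\ e)) S0 :\: C| <= k * #|S0 :\: C|.
  move/forallP: ok => /(_ (S0 :\: C)); apply: leq_trans.
  rewrite leq_mul2l subset_leq_card ?orbT //; apply/subsetP => w /setDP [wi wC].
  have [wS wN] := isolated_offP _ _ _ wi; apply/isolated_offP; split.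
    by rewrite inE negb_and wS orbT.
  move=> z wz; have zC : z \notin C.
    by apply: contra wC => zC; have := clC _ _ wz; rewrite /= => ->.
  rewrite inE zC; apply: wN; rewrite adjE wz; apply/eqP => ee.
  have : w \in e by rewrite -ee set21.
  rewrite /e !inE => /orP [] /eqP we; move: wC; rewrite we; apply/negP/negPn; exact: valP.
move=> lt; rewrite -(ltn_add2r (k * #|S0 :\: C|)); apply: leq_trans lt _.
by rewrite leq_add2l.
Qed.

(** Pass to an edge-minimal spanning subgraph satisfying the bound: its acyclic
    components are trees of the required class, and its other components are odd
    circuits of the required lengths. *)
Theorem isolation_bound_factor (r k : nat) (V : finType) (G : sgraph V) :
  0 < r -> r < k -> isolation_bound r k G -> has_factor (cycle_tree_class k r) G.
Proof.
move=> r0 rk ok.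
pose P (E : {set {set V}}) := isolation_bound r k (graph_of E).
have PG : P (edges G) by rewrite /P (eq_isolation_bound _ _ (@graph_of_edges _ G)).
have [E /minsetP [PE Emin] Esub] := minset_exists PG.
have Ep : edge_pairs E := edge_pairsS Esub (@edges_pairs _ G).
have mini e : e \in E -> ~~ isolation_bound r k (graph_of (E :\ e)).
  move=> eE; apply/negP => /(Emin (E :\ e)) /(_ (subsetDl _ _)) /setP /(_ e).
  by rewrite !inE eqxx eE.
exists (graph_of E); split.
  move=> x y /andP [xy xyE]; rewrite -(graph_of_edges G) /= /edge_set_rel xy.
  exact: (subsetP Esub).
move=> x.
have [[c [c_cycle c2 cx]]|nocyc] := pselect (exists c, [/\ ucycle (graph_of E) c, 2 < size c
    & nth x c 0 \in component (graph_of E) x]).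
  have mi : size c = 2 * (size c)./2 + 1.
    by rewrite -{1}(odd_double_half (size c)) (cycle_odd r0 rk Ep PE mini x c_cycle c2) -mul2n addnC.
  have x0C : component (graph_of E) x = component (graph_of E) (cyc c x 0).
    by rewrite (component_eq cx) /cyc mod0n.
  exists 'I_(size c), (circuit (size c)); split; last first.
    rewrite x0C; exact: (component_circuit r0 rk Ep PE mini).
  left; exists (size c)./2; split; first by lia.
    exact: (cycle_length r0 rk Ep PE mini x c_cycle c2).
  by rewrite -mi; exists id => //; exists id.
exists {y : V | y \in component (graph_of E) x}, (induced (graph_of E) (component (graph_of E) x)).
split; last by exists id => //; exists id.
right; apply: tree_component => // c cyc.
rewrite leqNgt; apply/negP => c2; apply: nocyc; exists (map val c); split.
- exact: ucycle_induced cyc.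
- by rewrite size_map.
- by case: c c2 {cyc} => //= u c _; apply: valP.
Qed.

Local Open Scope ring_scope.

(** * The condition on the order *)

(** Here p stands for k/r, d for the minimum degree, s = d + j for the size of a
    hub, a and a + u for the numbers of sinks belonging to hubs of size d and s,
    and M for n - a. The goal [s (a + u) (s + u) <= u M (M - 1)] says that the
    positive vector used in [large_hub_spectral] is a subsolution for the value
    M - 1. *)
Section OrderInequality.
Variable F : realFieldType.
Implicit Types p d j u a M A v s c : F.

(** Hub size d + 1. The sufficient condition [s + s a / u <= M - 1] of the larger
    sizes can just fail here, and the gap between M and s + u makes up for it. *)
Lemma order_condition_succ p d u a M :
  1 < p -> 1 <= d -> 0 <= a <= p * d + 1 -> p - 1 <= u -> u <= p + 1 ->
  (p + 1) * (p + 2) * (p * d + p + 1) <= p ^+ 2 * (M + p * d + 1) ->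
  2 * p * d ^+ 2 + (3 * p + 2) * d + p ^+ 2 + p <= 2 * (p - 1) * M ->
  (d + 1) * (a + u) * (d + 1 + u) <= u * M * (M - 1).
Proof.
move=> p1 d1 /andP [a0 ad] up uP h1 h2.
have p0 : 0 < p by lra.
have M1 : 3 * d + p + 3 <= M.
  rewrite -(ler_pM2l (exprn_gt0 2 p0)); nra.
(* M - 1 may fall short of s + s a / u, but by at most d / 2 *)
set D := M - 1 - (d + 1) + d / 2.
have D0 : 0 <= D by rewrite /D; lra.
have hD : (d + 1) * (p * d + 1) <= (p - 1) * D.
  have := sqr_ge0 (p - 3 / 2); rewrite /D; nra.
have hu : (d + 1) * a <= u * D.
  apply: le_trans (_ : (p - 1) * D <= _); last by apply: ler_wpM2r.
  by apply: le_trans hD; apply: ler_wpM2l => //; lra.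
have hs : (d + 1) * (a + u) <= u * (M - 1 + d / 2) by move: hu; rewrite /D; nra.
apply: (@le_trans _ _ (u * (M - 1 + d / 2) * (d + 1 + u))).
  by apply: ler_wpM2r => //; lra.
rewrite -!mulrA; apply: ler_wpM2l; first by lra.
have e : d / 2 <= M - (d + 1 + u) by lra.
have e' : d + 1 + u <= M - 1 by lra.
have : d / 2 * (d + 1 + u) <= (M - (d + 1 + u)) * (M - 1) by apply: ler_pM; lra.
lra.
Qed.

(** The difference of the two sides is a convex function of x. *)
Lemma quadratic_between (b c x lo hi : F) : lo <= x <= hi ->
  (b + lo) ^+ 2 <= c * lo -> (b + hi) ^+ 2 <= c * hi -> (b + x) ^+ 2 <= c * x.
Proof.
move=> /andP [lx xh] hl hh.
have [e|ne] := eqVneq lo hi; first by have -> : x = lo by lra.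
have lt : 0 < hi - lo by rewrite subr_gt0 lt_neqAle ne (le_trans lx).
rewrite -(ler_pM2l lt).
have h1 : (hi - x) * (b + lo) ^+ 2 <= (hi - x) * (c * lo) by apply: ler_wpM2l; lra.
have h2 : (x - lo) * (b + hi) ^+ 2 <= (x - lo) * (c * hi) by apply: ler_wpM2l; lra.
have h3 : 0 <= (x - lo) * (hi - x) * (hi - lo) by rewrite !mulr_ge0 //; lra.
nra.
Qed.

Lemma quadratic_at_low p d M : 1 < p -> 1 <= d ->
  2 * p * d ^+ 2 + (3 * p + 2) * d + p ^+ 2 + p <= 2 * (p - 1) * M ->
  (p * d + 1 + (2 * p - 1)) ^+ 2 <= p * (M - 1) * (2 * p - 1).
Proof.
move=> p1 d1 h2.
have -> : p * d + 1 + (2 * p - 1) = p * (d + 2) by ring.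
rewrite exprMn expr2 -!mulrA; apply: ler_wpM2l; first by lra.
have q0 : 0 < 2 * (p - 1) by lra.
rewrite -(ler_pM2l q0).
have h2' : (2 * p * d ^+ 2 + (3 * p + 2) * d + p ^+ 2 - p + 2) * (2 * p - 1) <=
   2 * (p - 1) * (M - 1) * (2 * p - 1) by apply: ler_wpM2r; lra.
rewrite [leRHS]mulrA; apply: le_trans h2'; rewrite -subr_ge0.
have -> : (2 * p * d ^+ 2 + (3 * p + 2) * d + p ^+ 2 - p + 2) * (2 * p - 1)
   - 2 * (p - 1) * (p * (d + 2) ^+ 2)
   = 2 * p ^+ 2 * d * (d - 1) + (d - 1) * (9 * p - 2)
     + p * (2 * (p - 11 / 4) ^+ 2) + (p * (55 / 8) - 4) by field.
have x3 : 0 <= p * (2 * (p - 11 / 4) ^+ 2).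
  by apply: mulr_ge0; [lra|apply: mulr_ge0; [lra|exact: sqr_ge0]].
have x1 : 0 <= 2 * p ^+ 2 * d * (d - 1).
  by rewrite !mulr_ge0 ?exprn_ge0 //; clear -p1 d1; lra.
have x2 : 0 <= (d - 1) * (9 * p - 2) by apply: mulr_ge0; clear -p1 d1; lra.
by clear -x1 x2 x3 p1; lra.
Qed.

Lemma quadratic_at_high_le2 p A M : 1 < p -> p <= 2 -> 0 < A ->
  (3 * p + 2) * A + p ^+ 3 + 2 * p ^+ 2 + 2 * p <= p ^+ 2 * (M - 1) ->
  (A + (2 * A / p + 1)) ^+ 2 <= p * (M - 1) * (2 * A / p + 1).
Proof.
move=> p1 p2 A0 M1; have p0 : 0 < p by lra.
have pN : p != 0 by rewrite lt0r_neq0.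
rewrite -(ler_pM2l (exprn_gt0 2 p0)).
have -> : p ^+ 2 * (A + (2 * A / p + 1)) ^+ 2 = (A * (p + 2) + p) ^+ 2 by field.
have -> : p ^+ 2 * (p * (M - 1) * (2 * A / p + 1)) = (2 * A + p) * (p ^+ 2 * (M - 1)) by field.
apply: (@le_trans _ _ ((2 * A + p) * ((3 * p + 2) * A + p ^+ 3 + 2 * p ^+ 2 + 2 * p))).
  rewrite -subr_ge0.
  have -> : (2 * A + p) * ((3 * p + 2) * A + p ^+ 3 + 2 * p ^+ 2 + 2 * p) - (A * (p + 2) + p) ^+ 2
    = A ^+ 2 * p * (2 - p) + 2 * A * p ^+ 3 + 5 * A * p ^+ 2 + 2 * A * p + p ^+ 4 + 2 * p ^+ 3 + p ^+ 2 by ring.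
  by rewrite !addr_ge0 ?mulr_ge0 ?exprn_ge0 //; clear -p0 p1 p2 A0; lra.
by apply: ler_wpM2l => //; lra.
Qed.

Lemma quadratic_at_high_small p d M : 2 < p -> 1 <= d -> d <= p + 2 ->
  (3 * p + 2) * (p * d + 1) + p ^+ 3 + 2 * p ^+ 2 + 2 * p <= p ^+ 2 * (M - 1) ->
  (p * d + 1 + (p * d + 1 + 1)) ^+ 2 <= p * (M - 1) * (p * d + 1 + 1).
Proof.
move=> p2 d1 dp M1; have p0 : 0 < p by lra.
have A1 : 0 <= p * d + 1 + 1 by rewrite !addr_ge0 // mulr_ge0; lra.
have hh := ler_wpM2l A1 M1.
rewrite -(ler_pM2l p0).
have -> : p * (p * (M - 1) * (p * d + 1 + 1)) = (p * d + 1 + 1) * (p ^+ 2 * (M - 1)) by ring.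
apply: le_trans hh; rewrite -subr_ge0.
have -> : (p * d + 1 + 1) * ((3 * p + 2) * (p * d + 1) + p ^+ 3 + 2 * p ^+ 2 + 2 * p)
    - p * (p * d + 1 + (p * d + 1 + 1)) ^+ 2
    = p ^+ 3 * d * (p + 2 - d) + p ^+ 2 * d * (d - 1) + p ^+ 2 * d ^+ 2 + 6 * p * d
      + 2 * p ^+ 3 + 4 * p ^+ 2 + p + 4 by ring.
by rewrite !addr_ge0 ?mulr_ge0 ?exprn_ge0 //; clear -p2 d1 dp; lra.
Qed.

Lemma quadratic_at_high_large p d M : 2 < p -> p + 2 <= d ->
  2 * p * d ^+ 2 + (3 * p + 2) * d + p ^+ 2 + p <= 2 * (p - 1) * M ->
  (p * d + 1 + (p * d + 1 + 1)) ^+ 2 <= p * (M - 1) * (p * d + 1 + 1).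
Proof.
move=> p2 dp h2; have p0 : 0 < p by lra.
have q0 : 0 < 2 * (p - 1) by lra.
have A1 : 0 <= p * (p * d + 1 + 1).
  by apply: mulr_ge0; [lra | rewrite !addr_ge0 // mulr_ge0; lra].
have hh : (2 * p * d ^+ 2 + (3 * p + 2) * d + p ^+ 2 - p + 2) * (p * (p * d + 1 + 1)) <=
     2 * (p - 1) * (M - 1) * (p * (p * d + 1 + 1)).
  by apply: ler_wpM2r; lra.
rewrite -(ler_pM2l q0).
have -> : 2 * (p - 1) * (p * (M - 1) * (p * d + 1 + 1))
  = 2 * (p - 1) * (M - 1) * (p * (p * d + 1 + 1)) by ring.
apply: le_trans hh; rewrite -subr_ge0.
have -> : (2 * p * d ^+ 2 + (3 * p + 2) * d + p ^+ 2 - p + 2) * (p * (p * d + 1 + 1))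
    - 2 * (p - 1) * (p * d + 1 + (p * d + 1 + 1)) ^+ 2
  = 2 * p ^+ 3 * d ^+ 2 * (d - (p + 2)) + d ^+ 2 * p ^+ 3 * (2 * p - 1)
    + 14 * p ^+ 2 * d * (d - 2) + 12 * p ^+ 2 * d + p ^+ 3 * d * (p - 1)
    + 28 * p * (d - 1) + 14 * p + 2 * p ^+ 2 * (p - 1) + 18 by ring.
by rewrite !addr_ge0 ?mulr_ge0 ?exprn_ge0 //; clear -p2 dp; lra.
Qed.

(** With [A = p d + 1] bounding a and [v = p j - 1] bounding u, one has
    [p s = A + v]. For large v, the condition needed follows from [s + u <= M] alone, and this is
    the first alternative. Otherwise v lies between [2 p - 1] and a bound of the
    order of A, and convexity reduces the second alternative to these two ends,
    where the lower bounds on M apply. The shape of the upper end depends on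
    whether p exceeds 2. *)
Lemma order_dichotomy p d A M v : A = p * d + 1 -> 1 < p -> 1 <= d -> 2 * p - 1 <= v ->
  (p + 1) * (p + 2) * (p * d + p + 1) <= p ^+ 2 * (M + p * d + 1) ->
  2 * p * d ^+ 2 + (3 * p + 2) * d + p ^+ 2 + p <= 2 * (p - 1) * M ->
  (A + v) * A <= p * (v * (v - 1)) \/ (A + v) ^+ 2 <= p * (M - 1) * v.
Proof.
move=> AE p1 d1 v1 h1 h2.
have p0 : 0 < p by lra.
have A0 : 0 < A by rewrite AE addr_gt0 ?mulr_gt0 //; lra.
have v0 : 0 < v by lra.
have low := quadratic_at_low p1 d1 h2; rewrite -AE in low.
have M1 : (3 * p + 2) * A + p ^+ 3 + 2 * p ^+ 2 + 2 * p <= p ^+ 2 * (M - 1).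
  by move: h1; rewrite AE; lra.
have [p2|p2] := leP p 2.
  have [vl|vs] := leP (2 * A / p + 1) v.
    left; have vA : 2 * A <= p * (v - 1) by rewrite [p * _]mulrC -ler_pdivrMr //; lra.
    have pA : p * A <= 2 * A by apply: ler_wpM2r => //; lra.
    have Av : A <= v - 1 by rewrite -(ler_pM2l p0); lra.
    have x1 : v * (2 * A) <= v * (p * (v - 1)) by apply: ler_wpM2l => //; lra.
    have x2 : A * A <= v * A by apply: ler_wpM2r; lra.
    by clear -x1 x2; lra.
  right; apply: (quadratic_between (lo := 2 * p - 1) (hi := 2 * A / p + 1)) => //.
    by rewrite v1 ltW.
  exact: quadratic_at_high_le2.
have [vl|vs] := leP (A + 1) v.
  left.
  have x1 : (A + v) * A <= 2 * v * A by apply: ler_wpM2r; lra.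
  have x2 : 2 * v * A <= 2 * v * (v - 1) by apply: ler_wpM2l; lra.
  have x3 : 2 * (v * (v - 1)) <= p * (v * (v - 1)).
    by apply: ler_wpM2r; [apply: mulr_ge0|]; lra.
  by clear -x1 x2 x3; lra.
right; apply: (quadratic_between (lo := 2 * p - 1) (hi := A + 1)) => //.
  by rewrite v1 ltW.
rewrite AE in M1 *; have [dp|dp] := leP d (p + 2); first exact: quadratic_at_high_small.
by apply: quadratic_at_high_large => //; apply: ltW.
Qed.

(** Hub size at least d + 2. *)
Lemma order_condition_far p d j u a M :
  1 < p -> 1 <= d -> 2 <= j -> 0 <= a <= p * d + 1 -> p * j - 1 <= u ->
  d + j + u <= M ->
  (p + 1) * (p + 2) * (p * d + p + 1) <= p ^+ 2 * (M + p * d + 1) ->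
  2 * p * d ^+ 2 + (3 * p + 2) * d + p ^+ 2 + p <= 2 * (p - 1) * M ->
  (d + j) * (a + u) * (d + j + u) <= u * M * (M - 1).
Proof.
move=> p1 d1 j2 /andP [a0 ad] uv sM h1 h2.
have p0 : 0 < p by lra.
have v1 : 2 * p - 1 <= p * j - 1.
  by rewrite lerD2r [leLHS]mulrC; apply: ler_wpM2l; lra.
have btw := order_dichotomy erefl p1 d1 v1 h1 h2; clear h1 h2.
have [A AE] : exists A, A = p * d + 1 by exists (p * d + 1).
have [v vE] : exists v, v = p * j - 1 by exists (p * j - 1).
have [s sE] : exists s, s = d + j by exists (d + j).
have ps : p * s = A + v by rewrite AE vE sE; ring.
have s0 : 0 <= s by rewrite sE; lra.
have v0 : 1 < v by rewrite vE; lra.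
rewrite -vE -AE -?sE in btw ad uv sM *.
clear v1 vE AE sE d1 j2.
(* together with s + u <= M this is enough *)
suff T : s * A <= u * (M - 1 - s).
  have hs : s * (a + u) <= u * (M - 1).
    have : s * a <= s * A by apply: ler_wpM2l.
    by lra.
  apply: (@le_trans _ _ (u * (M - 1) * (s + u))).
    by apply: ler_wpM2r => //; lra.
  rewrite -!mulrA [M * _]mulrC; apply: ler_wpM2l; first by lra.
  by apply: ler_wpM2l => //; lra.
case: btw => [large|small].
  apply: (@le_trans _ _ (v * (v - 1))).
    by rewrite -(ler_pM2l p0) mulrA ps.
  by apply: ler_pM; lra.
have h : v * s + s * A <= v * (M - 1).
  rewrite -(ler_pM2l p0).
  have -> : p * (v * s + s * A) = (A + v) ^+ 2 by rewrite -ps; rewrite (_ : v = p * s - A); [ring|lra].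
  by clear -small; lra.
apply: (@le_trans _ _ (v * (M - 1 - s))); first by lra.
by apply: ler_wpM2r; lra.
Qed.

End OrderInequality.

(** X and Y stand for the floors of K s / r and K d / r, of which only the defining
    inequalities are used. *)
Lemma order_condition_real (F : realFieldType) (K r d j X Y n : F) :
  0 < r -> r < K -> 1 <= d -> j = 1 \/ 2 <= j -> 0 <= Y ->
  X * r <= K * (d + j) < (X + 1) * r -> Y * r <= K * d < (Y + 1) * r ->
  d + j + (X + 1) <= n ->
  (K + r) * (K + 2 * r) * (K * d + K + r) / (K ^+ 2 * r) <= n ->
  (2 * K * r * d ^+ 2 + (2 * K ^+ 2 + K * r + 2 * r ^+ 2) * d
     + K ^+ 2 + 3 * K * r - 2 * r ^+ 2) / (2 * r * (K - r)) <= n ->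
  (d + j) * (X + 1) * (d + j + (X - Y))
    <= (X - Y) * (n - (Y + 1)) * (n - (Y + 1) - 1).
Proof.
move=> r0 rK d1 j12 Y0 /andP [X1 X2] /andP [Y1 Y2] jn h1 h2.
pose p := K / r; have kp : K = p * r by rewrite /p divfK // lt0r_neq0.
have p1 : 1 < p by rewrite /p ltr_pdivlMr // mul1r.
move: (p) p1 kp => {}p p1 kp; subst K; clear rK.
have r1 : r != 0 by rewrite lt0r_neq0.
have Xle : X <= p * (d + j) by rewrite -(ler_pM2r r0) [leRHS]mulrAC.
have Xgt : p * (d + j) < X + 1 by rewrite -(ltr_pM2r r0) [ltLHS]mulrAC.
have Yle : Y <= p * d by rewrite -(ler_pM2r r0) [leRHS]mulrAC.
have Ygt : p * d < Y + 1 by rewrite -(ltr_pM2r r0) [ltLHS]mulrAC.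
clear X1 X2 Y1 Y2.
have pN : p != 0 by rewrite lt0r_neq0 // (lt_trans _ p1).
have qN : p - 1 != 0 by rewrite lt0r_neq0 // subr_gt0.
have e1 : (p * r + r) * (p * r + 2 * r) * (p * r * d + p * r + r) / ((p * r) ^+ 2 * r)
     = (p + 1) * (p + 2) * (p * d + p + 1) / p ^+ 2.
  by field; rewrite pN r1.
have e2 : (2 * (p * r) * r * d ^+ 2 + (2 * (p * r) ^+ 2 + p * r * r + 2 * r ^+ 2) * d
    + (p * r) ^+ 2 + 3 * (p * r) * r - 2 * r ^+ 2) / (2 * r * (p * r - r))
    = (2 * p * d ^+ 2 + (2 * p ^+ 2 + p + 2) * d + p ^+ 2 + 3 * p - 2) / (2 * (p - 1)).
  field; have -> : p * r - r = (p - 1) * r by ring.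
  by rewrite r1 qN mulf_neq0.
have q0 : 0 < 2 * (p - 1) by clear -p1; lra.
have p0 : 0 < p ^+ 2 by apply: exprn_gt0; clear -p1; lra.
rewrite e1 ler_pdivrMr // in h1; rewrite e2 ler_pdivrMr // in h2.
clear e1 e2 r0 r1 r.
have nY : n <= n - (Y + 1) + p * d + 1 by clear -Yle; lra.
have g1 : (p + 1) * (p + 2) * (p * d + p + 1) <= p ^+ 2 * (n - (Y + 1) + p * d + 1).
  by apply: le_trans h1 _; rewrite mulrC; apply: ler_wpM2l => //; apply: ltW.
have g2 : 2 * p * d ^+ 2 + (3 * p + 2) * d + p ^+ 2 + p <= 2 * (p - 1) * (n - (Y + 1)).
  have h3 := ler_wpM2l (ltW q0) nY; clear -h2 h3; lra.
have -> : X + 1 = (Y + 1) + (X - Y) by ring.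
have a_le : 0 <= Y + 1 <= p * d + 1 by apply/andP; split; clear -Y0 Yle; lra.
have [j1|j2] := j12.
  subst j; apply: (order_condition_succ p1) => //; clear -Xgt Ygt Xle Yle; lra.
by apply: (order_condition_far p1) => //; clear -jn Xgt Yle; lra.
Qed.

Lemma order_condition (F : realFieldType) (k r n delta s : nat)
    (a := (k * delta %/ r + 1)%N) (t := (k * s %/ r + 1)%N) :
  (0 < r)%N -> (r < k)%N -> (0 < delta)%N -> (delta < s)%N -> (s + t <= n)%N ->
  (let K : F := k%:R in let r' : F := r%:R in let d : F := delta%:R in
    Num.max
        ((K + r') * (K + 2 * r') * (K * d + K + r') / (K ^+ 2 * r'))
        ((2 * K * r' * d ^+ 2 + (2 * K ^+ 2 + K * r' + 2 * r' ^+ 2) * d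
            + K ^+ 2 + 3 * K * r' - 2 * r' ^+ 2)
           / (2 * r' * (K - r')))
      <= n%:R) ->
  (a < t)%N /\ (s * t * (s + (t - a)) <= (t - a) * (n - a) * (n - a - 1))%N.
Proof.
move=> r0 rk d0 ds; rewrite {}/a {}/t => stn; lazy zeta; rewrite ge_max => /andP [h1 h2].
have XY : (k * delta %/ r + (s - delta) <= k * s %/ r)%N.
  rewrite addnC -divnMDl //; apply: leq_div2r.
  have -> : (k * s = (s - delta) * k + k * delta)%N.
    by rewrite [((s - delta) * k)%N]mulnC -mulnDr subnK // ltnW.
  by rewrite leq_add2r leq_mul2l ltnW ?orbT.
have X1 := leq_divM (k * s) r; have X2 := ltn_ceil (k * s) r0.
have Y1 := leq_divM (k * delta) r; have Y2 := ltn_ceil (k * delta) r0.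
move: (k * s %/ r)%N (k * delta %/ r)%N XY X1 X2 Y1 Y2 stn => X Y XY X1 X2 Y1 Y2 stn.
have YX : (Y <= X)%N by apply: leq_trans XY; apply: leq_addr.
have YX1 : (Y < X)%N by apply: leq_trans XY; rewrite -addn1 leq_add2l subn_gt0.
split; first by rewrite ltn_add2r.
have an : (Y + 1 <= n)%N by apply: leq_trans stn; rewrite addnA leq_add2r (leq_trans YX) ?leq_addl.
have an1 : (1 <= n - (Y + 1))%N.
  rewrite subn_gt0; apply: leq_trans stn; rewrite addn1 addn1 addnS !ltnS.
  by apply: leq_trans YX1 (leq_addl _ _).
rewrite subnDr -(ler_nat F) !natrM !natrD !natrB // ?natrD.
have sE : s%:R = delta%:R + (s - delta)%:R :> F by rewrite -natrD subnKC // ltnW.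
rewrite sE; apply: (@order_condition_real F k%:R r%:R) => //.
- by rewrite ltr0n.
- by rewrite ltr_nat.
- by rewrite ler1n.
- have : (0 < s - delta)%N by rewrite subn_gt0.
  case: (s - delta)%N => [//|[|j]] _; [by left | right].
  by rewrite (ler_nat _ 2).
- by rewrite -sE natr1 -!natrM ler_nat ltr_nat X1.
- by rewrite natr1 -!natrM ler_nat ltr_nat Y1.
- by rewrite -sE natr1 -natrD ler_nat -addn1.
Qed.

(** * Positive vectors and the spectral radius *)

Section Spectral.
Variables (R : realType) (V : finType) (G : sgraph V).
Implicit Types (y z : V -> R) (a theta : R).

Definition nbr_sum (z : V -> R) v : R := \sum_(w | G v w) z w.

Lemma eigenvalue_adjP a :
  eigenvalue (adjmx G R) a <->
  exists y, (exists v, y v != 0) /\ forall v, nbr_sum y v = a * y v.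
Proof.
have entry (u : 'rV[R]_#|V|) i :
    (u *m adjmx G R) 0 i = nbr_sum (fun w => u 0 (enum_rank w)) (enum_val i).
  rewrite mxE /nbr_sum [RHS]big_mkcond /= [RHS](reindex (@enum_val V V)) /=; last first.
    by apply: onW_bij; apply: enum_val_bij.
  apply: eq_bigr => j _; rewrite mxE enum_valK (edge_sym G).
  by case: ifP; rewrite (mulr1, mulr0).
split=> [/eigenvalueP [u ua u0]|[y [[v yv] ya]]].
  exists (fun w => u 0 (enum_rank w)); split.
    have /existsP [i ui] : [exists i, u 0 i != 0].
      apply: contraR u0; rewrite negb_exists => /forallP z.
      by apply/eqP/rowP => i; have := z i; rewrite negbK mxE => /eqP.
    by exists (enum_val i); rewrite enum_valK.
  by move=> v; rewrite -[v in LHS]enum_rankK -entry ua mxE.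
apply/eigenvalueP; exists (\row_i y (enum_val i)).
  apply/rowP => i; rewrite entry !mxE -ya; apply: eq_bigr => w _.
  by rewrite mxE enum_rankK.
apply/negP => /eqP /rowP /(_ (enum_rank v)); rewrite !mxE enum_rankK.
exact/eqP.
Qed.

Section Comparison.
Variables (z : V -> R) (theta : R).
Hypothesis z_gt0 : forall v, 0 < z v.
Hypothesis z_sub : forall v, nbr_sum z v <= theta * z v.

Lemma max_ratio y a : (exists v, y v != 0) -> (forall v, nbr_sum y v = a * y v) ->
  exists c v, [/\ 0 < c, `|y v| = c * z v & forall w, `|y w| <= c * z w].
Proof.
move=> [v0 yv0] ya.
have [v _ vmax] := @arg_maxP _ _ _ v0 predT (fun v => `|y v| / z v) isT.
exists (`|y v| / z v), v; split.
- apply: lt_le_trans (vmax v0 isT); by rewrite divr_gt0 ?normr_gt0.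
- by rewrite divfK // lt0r_neq0.
- by move=> w; rewrite -ler_pdivrMr //; exact: vmax.
Qed.

(** At a vertex v where |y| / z is maximal, [|a| |y v|] is at most the sum of |y|
    over the neighbours of v, hence at most [theta |y v|]. Equality forces the
    ratio to be maximal at all neighbours as well. *)
Lemma max_ratio_propagates y a c v : (forall v, nbr_sum y v = a * y v) ->
  0 < c -> `|y v| = c * z v -> (forall w, `|y w| <= c * z w) ->
  `|a| <= theta /\
  (theta <= `|a| -> nbr_sum z v = theta * z v /\ forall w, G v w -> `|y w| = c * z w).
Proof.
move=> ya c0 yv yw.
have h1 : `|a| * (c * z v) <= \sum_(w | G v w) `|y w|.
  by rewrite -yv -normrM -ya; apply: ler_norm_sum.
have h2 : \sum_(w | G v w) `|y w| <= \sum_(w | G v w) c * z w by apply: ler_sum.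
have h3 : \sum_(w | G v w) c * z w <= theta * (c * z v).
  by rewrite -mulr_sumr mulrCA; apply: ler_wpM2l; [exact: ltW | exact: z_sub].
have cz : 0 < c * z v by rewrite mulr_gt0.
split; first by rewrite -(ler_pM2r cz); apply: le_trans h1 (le_trans h2 h3).
rewrite -(ler_pM2r cz) => h4.
have e : \sum_(w | G v w) c * z w = theta * (c * z v).
  by apply/eqP; rewrite eq_le h3 (le_trans h4) // (le_trans h1).
split.
  by apply: (mulfI (lt0r_neq0 c0)); rewrite mulrCA -e mulr_sumr.
have : \sum_(w | G v w) (c * z w - `|y w|) == 0.
  by rewrite sumrB subr_eq0 eq_le h2 andbT e (le_trans h4).
rewrite psumr_eq0; last by move=> w _; rewrite subr_ge0.
by move=> /allP all0 w vw; apply/esym/eqP; rewrite -subr_eq0; move: (all0 w (mem_index_enum w)); rewrite vw.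
Qed.

Lemma eigenvalue_le a : eigenvalue (adjmx G R) a -> `|a| <= theta.
Proof.
move=> /eigenvalue_adjP [y [y0 ya]].
have [c [v [c0 yv yw]]] := max_ratio y0 ya.
by have [] := max_ratio_propagates ya c0 yv yw.
Qed.

(** In case of equality the maximal ratio propagates along paths to v, where the
    inequality for z is strict. *)
Lemma eigenvalue_lt a v : (forall u w : V, connect G u w) -> nbr_sum z v < theta * z v ->
  eigenvalue (adjmx G R) a -> `|a| < theta.
Proof.
move=> conn strict /eigenvalue_adjP [y [y0 ya]].
have [c [u [c0 yu yw]]] := max_ratio y0 ya.
rewrite ltNge; apply/negP => ge.
have /connectP [p pth lst] := conn u v.
elim: p u pth lst yu => [|w p IH] u /=.
  move=> _ ev; subst u => yv; have [_ /(_ ge) [e _]] := max_ratio_propagates ya c0 yv yw.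
  by rewrite e ltxx in strict.
move=> /andP [uw pth] lst yu; apply: (IH w) => //.
by have [_ /(_ ge) [_ nb]] := max_ratio_propagates ya c0 yu yw; apply: nb.
Qed.

End Comparison.

(** Finiteness of the spectrum is what turns strict bounds on the eigenvalues into
    a strict bound on their supremum. *)
Lemma poly_roots_seq (F : fieldType) (p : {poly F}) : p != 0 ->
  exists s : seq F, forall x, root p x -> x \in s.
Proof.
have [n le_n] := ubnP (size p); elim: n p le_n => // n IH p le_n p0.
have [[x rx]|nox] := pselect (exists x, root p x); last first.
  by exists [::] => x rx; case: nox; exists x.
have [q pq] := factor_theorem _ _ rx.
have q0 : q != 0 by apply: contraNneq p0 => q0; rewrite pq q0 mul0r.
have [|s hs] := IH q _ q0.
  by move: le_n; rewrite pq size_Mmonic ?monicXsubC // size_XsubC addn2 /= ltnS.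
exists (x :: s) => w; rewrite pq rootM root_XsubC inE => /orP [/hs -> | ->] //.
by rewrite orbT.
Qed.

Lemma spectral_radius_le theta : 0 <= theta ->
  (forall a, eigenvalue (adjmx G R) a -> a <= theta) -> spectral_radius G R <= theta.
Proof.
move=> t0 h; rewrite /spectral_radius; set A := (X in sup X).
have [[a Aa]|no] := pselect (exists a, A a).
  by apply: ge_sup => //; exists a.
have -> : A = classical_sets.set0; last by rewrite sup0.
by apply/classical_sets.seteqP; split=> // a Aa; case: no; exists a.
Qed.

Lemma spectral_radius_lt theta : 0 < theta ->
  (forall a, eigenvalue (adjmx G R) a -> a < theta) -> spectral_radius G R < theta.
Proof.
move=> t0 h.
have [s hs] := poly_roots_seq (monic_neq0 (char_poly_monic (adjmx G R))).
(* the largest of finitely many candidates, with 0 covering an empty list *)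
pose b := \big[Num.max/0]_(x <- s | x < theta) x.
apply: (@le_lt_trans _ _ b); last first.
  by rewrite /b; elim/big_ind: _ => // x y xt yt; rewrite gt_max xt.
apply: spectral_radius_le => [|a ea].
  by rewrite /b; apply: bigmax_ge_id.
have as_ : a \in s by apply: hs; rewrite -eigenvalue_root_char.
by rewrite /b; apply: le_bigmax_seq => //; apply: h.
Qed.

Lemma le_spectral_radius theta a : (forall a, eigenvalue (adjmx G R) a -> a <= theta) ->
  eigenvalue (adjmx G R) a -> a <= spectral_radius G R.
Proof.
move=> h ea; apply: sup_upper_bound => //; split; first by exists a.
by exists theta => b /h.
Qed.

End Spectral.

(** * Block graphs *)

(** A vertex partition into a hub, joined to everything, a clique, and an
    independent set of sinks whose neighbours all lie in the hub. The three labels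
    are encoded in [option bool] to inherit its finite type structure. *)
Definition part := option bool.
Definition hub : part := Some true.
Definition clique : part := None.
Definition sink : part := Some false.

Definition joined (c c' : part) : bool :=
  ((c == sink) ==> (c' == hub)) && ((c' == sink) ==> (c == hub)).

Section Block.
Variables (V : finType) (kappa : V -> part).

Definition block_rel : rel V := fun x y => (x != y) && joined (kappa x) (kappa y).

Lemma block_sym : symmetric block_rel.
Proof. by move=> x y; rewrite /block_rel eq_sym /joined andbC [in RHS]andbC; congr (_ && _); rewrite andbC. Qed.

Lemma block_irr : irreflexive block_rel.
Proof. by move=> x; rewrite /block_rel eqxx. Qed.

Definition block_graph : sgraph V := SGraph block_sym block_irr.

Definition part_size (c : part) : nat := #|[set v | kappa v == c]|.

Lemma big_part (R : zmodType) (f : part -> R) :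
  \sum_c f c = f hub + f clique + f sink.
Proof.
rewrite (bigD1 hub) //= (bigD1 clique) //= (bigD1 sink) //= big1 ?addr0 ?addrA //.
by case=> [[]|].
Qed.

Lemma card_parts : #|V| = (part_size hub + part_size clique + part_size sink)%N.
Proof.
rewrite -sum1_card (partition_big kappa predT) //=.
have e c : (\sum_(i | kappa i == c) 1 = part_size c)%N.
  by rewrite sum1_card; apply: eq_card => v; rewrite inE.
rewrite (bigD1 hub) //= e (bigD1 clique) //= e (bigD1 sink) //= e big1 ?addn0 ?addnA //.
by case=> [[]|].
Qed.

Lemma nbr_sum_block (R : realType) (x : part -> R) v :
  nbr_sum block_graph (x \o kappa) v =
  \sum_c (joined (kappa v) c)%:R * ((part_size c)%:R * x c)
    - (joined (kappa v) (kappa v))%:R * x (kappa v).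
Proof.
have -> : nbr_sum block_graph (x \o kappa) v =
   \sum_(w | joined (kappa v) (kappa w)) x (kappa w)
    - (joined (kappa v) (kappa v))%:R * x (kappa v).
  rewrite /nbr_sum /= /block_rel.
  have [jv|jv] := boolP (joined (kappa v) (kappa v)).
    rewrite [in RHS](bigD1 v) //= mul1r addrAC subrr add0r; apply: eq_bigl => w.
    by rewrite eq_sym andbC.
  rewrite mul0r subr0; apply: eq_bigl => w; have [<-|//] := eqVneq v w.
  by rewrite (negPf jv).
congr (_ - _); rewrite (partition_big kappa predT) //=; apply: eq_bigr => c _.
have [jc|jc] := boolP (joined (kappa v) c).
  rewrite mul1r (eq_bigr (fun=> x c)); last by move=> w /andP [_ /eqP ->].
  rewrite sumr_const mulr_natl; congr (_ *+ _); apply: eq_card => w; rewrite inE -topredE /=.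
  by case: eqP => [->|]; rewrite ?jc ?andbF.
rewrite mul0r big1 // => w /andP [jw /eqP e].
by rewrite -e jw in jc.
Qed.

End Block.

(** Match the classes in the order of their enumerations. *)
Lemma part_bijection (K V W : finType) (kV : V -> K) (kW : W -> K) :
  (forall c, #|[set v | kV v == c]| = #|[set w | kW w == c]|) ->
  exists2 f : V -> W, bijective f & forall v, kW (f v) = kV v.
Proof.
move=> ec.
have enW v : (index v (enum [set u | kV u == kV v]) < size (enum [set w | kW w == kV v]))%N.
  by rewrite -cardE -ec cardE index_mem mem_enum inE.
have nth0 v : exists w : W, w \in [set w | kW w == kV v].
  by apply/card_gt0P; rewrite -ec; apply/card_gt0P; exists v; rewrite inE.
pose f v := nth (xchoose (nth0 v)) (enum [set w | kW w == kV v])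
   (index v (enum [set u | kV u == kV v])).
have fk v : kW (f v) = kV v.
  by have := mem_nth (xchoose (nth0 v)) (enW v); rewrite mem_enum inE => /eqP.
exists f => //; apply: inj_card_bij.
  move=> u v e; have ek : kV u = kV v by rewrite -!fk e.
  move: e; rewrite /f.
  rewrite (set_nth_default (xchoose (nth0 v)) (xchoose (nth0 u))) ?enW // ek => /eqP.
  rewrite nth_uniq ?enum_uniq -?ek ?enW //; last by rewrite ek enW.
  move=> /eqP ie.
  have vin : v \in enum [set w | kV w == kV u] by rewrite mem_enum inE ek.
  rewrite -(nth_index v vin) -ie nth_index //.
  by rewrite mem_enum inE.
rewrite -!sum1_card (partition_big kV predT) //= (partition_big kW predT) //=.
apply/eq_leq/esym; apply: eq_bigr => c _; rewrite !sum1_card.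
by have := ec c; rewrite !cardsE.
Qed.

Lemma block_iso (V W : finType) (kV : V -> part) (kW : W -> part)
    (G : sgraph V) (H : sgraph W) :
  G =2 block_rel kV -> H =2 block_rel kW ->
  (forall c, part_size kV c = part_size kW c) -> graph_iso G H.
Proof.
move=> GV HW /part_bijection [f fb fk]; exists f => // x y.
by rewrite GV HW /block_rel !fk (inj_eq (bij_inj fb)).
Qed.

(** The graph [extremal_graph k r d n] is the case where q and t are given in terms
    of n. *)
Section Extremal.
Variables (d q t : nat).
Let W := ('I_d + ('I_q + 'I_t))%type.
Definition ext_graph : sgraph W :=
  graph_join (complete_graph d) (graph_union (complete_graph q) (edgeless_graph t)).
Definition ext_part (w : W) : part :=
  match w with inl _ => hub | inr (inl _) => clique | inr (inr _) => sink end.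

Lemma ext_block : ext_graph =2 block_rel ext_part.
Proof.
move=> [x|[x|x]] [y|[y|y]]; rewrite /= /block_rel /complete_edge ?andbT ?andbF //=.
Qed.

Lemma ext_part_size c : part_size ext_part c = if c is Some b then (if b then d else t) else q.
Proof.
have image_size m (f : 'I_m -> W) : injective f ->
    (forall w, ext_part w = c <-> exists i, w = f i) -> part_size ext_part c = m.
  move=> inj fP; rewrite -[RHS]card_ord -cardsT -(card_imset _ inj); apply: eq_card => w.
  rewrite [LHS]inE; apply/eqP/imsetP => [/fP [i ->]|[i _ ->]]; first by exists i.
  by apply/fP; exists i.
case: c image_size => [[]|] image_size.
- apply: (image_size _ (fun x => inl x)) => [x y []//|[x|[x|x]]]; split=> // h;
    by [case: h | exists x].
- apply: (image_size _ (fun x => inr (inr x))) => [x y []//|[x|[x|x]]]; split=> // h;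
    by [case: h | exists x].
- apply: (image_size _ (fun x => inr (inl x))) => [x y []//|[x|[x|x]]]; split=> // h;
    by [case: h | exists x].
Qed.

End Extremal.

Section BlockSpectrum.
Variables (R : realType) (V : finType) (kappa : V -> part).
Local Notation sz c := ((part_size kappa c)%:R : R).

(** The hub weight is normalised to 1. *)
Definition weight (xq xi : R) (c : part) : R :=
  if c is Some b then (if b then 1 else xi) else xq.

Lemma nbr_sum_weight xq xi v :
  nbr_sum (block_graph kappa) (weight xq xi \o kappa) v =
  match kappa v with
  | Some true => sz hub - 1 + sz clique * xq + sz sink * xi
  | None => sz hub + (sz clique - 1) * xq
  | Some false => sz hub
  end.
Proof.
rewrite nbr_sum_block big_part; case: (kappa v) => [[]|];
  by rewrite /joined /=; ring.
Qed.

Lemma subgraph_nbr_sum (G : sgraph V) (z : V -> R) v :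
  (forall w, 0 < z w) -> subrel G (block_graph kappa) ->
  nbr_sum G z v <= nbr_sum (block_graph kappa) z v.
Proof.
move=> z0 sub; 
rewrite /nbr_sum [leRHS](bigID (G v)) /= [leLHS](_ : _ = \sum_(w | block_rel kappa v w && G v w) z w).
  by rewrite lerDl sumr_ge0 // => w _; apply: ltW.
by apply: eq_bigl => w; apply/idP/andP => [vw|[]//]; split=> //; apply: sub.
Qed.

Lemma subgraph_nbr_sum_lt (G : sgraph V) (z : V -> R) v w :
  (forall w, 0 < z w) -> subrel G (block_graph kappa) ->
  block_graph kappa v w -> ~~ G v w ->
  nbr_sum G z v < nbr_sum (block_graph kappa) z v.
Proof.
move=> z0 sub bvw gvw.
rewrite /nbr_sum [ltRHS](bigID (G v)) /= [ltLHS](_ : _ = \sum_(w | block_rel kappa v w && G v w) z w).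
  rewrite ltrDl (bigD1 w) /=; last exact/andP.
  by apply: ltr_wpDr; [apply: sumr_ge0 => u _; exact: ltW | exact: z0].
by apply: eq_bigl => u; apply/idP/andP => [vw|[]//]; split=> //; apply: sub.
Qed.

End BlockSpectrum.

(** * The spectrum of block graphs *)

Section Quotient.
Variable R : realType.

(** The equation is the characteristic equation of the quotient of a block graph
    with hub size d, clique size q and a sinks. The lower bound on theta is the
    spectral radius of a complete graph on hub and clique. *)
Lemma quotient_root (d q a : nat) : (0 < d)%N -> (0 < a)%N ->
  exists2 theta : R, q%:R + d%:R - 1 < theta &
    theta * (theta - d%:R + 1) * (theta - q%:R + 1)
      = q%:R * d%:R * theta + a%:R * d%:R * (theta - q%:R + 1).
Proof.
move=> d0 a0.
have d1 : 1 <= d%:R :> R by rewrite ler1n.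
have a1 : 1 <= a%:R :> R by rewrite ler1n.
have q1 : 0 <= q%:R :> R by [].
move: (d%:R : R) (q%:R : R) (a%:R : R) d1 q1 a1 => D Q A d1 q1 a1.
(* negative at q + d - 1 and nonnegative at the order q + d + a *)
pose P : {poly R} := 'X * ('X - (D - 1)%:P) * ('X - (Q - 1)%:P)
   - (Q * D)%:P * 'X - (A * D)%:P * ('X - (Q - 1)%:P).
have PE x : P.[x] = x * (x - (D - 1)) * (x - (Q - 1)) - Q * D * x - A * D * (x - (Q - 1)).
  by rewrite /P !hornerE.
have lo : P.[Q + D - 1] < 0.
  rewrite PE (_ : _ - _ = - (A * D * D)); last by ring.
  by rewrite oppr_lt0 !mulr_gt0 //; lra.
have hi : 0 <= P.[Q + D + A].
  rewrite PE (_ : _ - _ = (Q + D + A) * ((A + 1) * Q)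
      + (Q + A) * ((A + 1) * (D + A + 1)) + D * (D + A + 1)); last by ring.
  by rewrite !addr_ge0 // !mulr_ge0 ?addr_ge0 //; lra.
have ab : Q + D - 1 <= Q + D + A by lra.
have sgn : P.[Q + D - 1] <= 0 <= P.[Q + D + A] by rewrite (ltW lo) hi.
have [x /andP [xlo xhi] /rootP rx] := poly_ivt ab sgn.
exists x.
  rewrite lt_neqAle xlo andbT; apply/eqP => e; rewrite -e in rx.
  by rewrite rx ltxx in lo.
by move: rx; rewrite PE; lra.
Qed.

Variables (V : finType) (kappa : V -> part).
Local Notation sz c := ((part_size kappa c)%:R : R).

Lemma block_eigen theta : 0 < theta -> 0 < theta - sz clique + 1 ->
  theta * (theta - sz hub + 1) * (theta - sz clique + 1)
    = sz clique * sz hub * theta + sz sink * sz hub * (theta - sz clique + 1) ->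
  let z := weight (sz hub / (theta - sz clique + 1)) (sz hub / theta) \o kappa in
  forall v, nbr_sum (block_graph kappa) z v = theta * z v.
Proof.
move=> t0 q0 e z v; rewrite nbr_sum_weight /z /=.
have tN : theta != 0 by rewrite lt0r_neq0.
have qN : theta - sz clique + 1 != 0 by rewrite lt0r_neq0.
case: (kappa v) => [[]|] /=.
- move: e; set D := sz hub; set Q := sz clique in q0 qN *; set A := sz sink => e.
  apply: (mulfI (mulf_neq0 tN qN)).
  have -> : theta * (theta - Q + 1) * (D - 1 + Q * (D / (theta - Q + 1)) + A * (D / theta))
    = theta * (theta - Q + 1) * (D - 1) + (Q * D * theta + A * D * (theta - Q + 1)).
    by field; rewrite tN qN.
  by rewrite -e; ring.
- by rewrite mulrCA divff // mulr1.
- by field.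
Qed.

Lemma weight_gt0 xq xi v : 0 < xq -> 0 < xi -> 0 < (weight xq xi \o kappa) v :> R.
Proof. by move=> q0 i0; rewrite /=; case: (kappa v) => [[]|] /=. Qed.

End Quotient.

Section Comparisons.
Variables (R : realType) (V : finType) (kappa : V -> part).
Local Notation sz c := ((part_size kappa c)%:R : R).

(** The positive eigenvector of the block graph for theta bounds the eigenvalues of
    all its subgraphs, strictly if the subgraph is connected and proper; and theta
    is an eigenvalue of every graph with the same block structure. *)
Lemma block_spectral :
  (0 < part_size kappa hub)%N -> (0 < part_size kappa sink)%N ->
  exists theta : R, [/\ sz clique + sz hub - 1 < theta,
    forall G : sgraph V, subrel G (block_graph kappa) -> (forall u w : V, connect G u w) ->
      ~ (G =2 block_rel kappa) -> spectral_radius G R < theta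
    & forall (W : finType) (kW : W -> part) (H : sgraph W), H =2 block_rel kW ->
       (forall c, part_size kW c = part_size kappa c) -> theta <= spectral_radius H R].
Proof.
move=> d0 a0.
have [theta lt e] := quotient_root R (part_size kappa clique) d0 a0.
have d1 : 1 <= sz hub by rewrite ler1n.
have q1 : 0 <= sz clique by [].
have t0 : 0 < theta by lra.
have q0 : 0 < theta - sz clique + 1 by lra.
have xq0 : 0 < sz hub / (theta - sz clique + 1) by rewrite divr_gt0 //; lra.
have xi0 : 0 < sz hub / theta by rewrite divr_gt0 //; lra.
exists theta; split=> //.
  move=> G sub conn nb; apply: spectral_radius_lt => // b eb; apply: le_lt_trans (ler_norm b) _.
  have z0 := fun v => weight_gt0 kappa v xq0 xi0.
  have eig := block_eigen t0 q0 e.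
  have [v [w [bvw gvw]]] : exists v w, block_rel kappa v w /\ ~~ G v w.
    apply: contrapT => no; apply: nb => v w; apply/idP/idP; first exact: sub.
    by move=> bvw; apply/negPn/negP => gvw; apply: no; exists v, w.
  apply: (eigenvalue_lt z0 _ conn (v := v) _ eb).
    by move=> u; rewrite -eig; apply: subgraph_nbr_sum.
  by rewrite -eig; apply: (subgraph_nbr_sum_lt (w := w)).
move=> W kW H HW szW.
have eig : forall v, nbr_sum H (weight (sz hub / (theta - sz clique + 1)) (sz hub / theta) \o kW) v
    = theta * (weight (sz hub / (theta - sz clique + 1)) (sz hub / theta) \o kW) v.
  move=> v; rewrite -!szW -block_eigen ?szW //.
  by apply: eq_bigl => w; rewrite HW.
have z0 := fun v => weight_gt0 kW v xq0 xi0.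
apply: le_spectral_radius => [b eb|].
  apply: le_trans (ler_norm b) _; apply: (eigenvalue_le z0 _ eb) => v; by rewrite eig.
apply/eigenvalue_adjP; eexists; split; last exact: eig.
have /card_gt0P [w _] : (0 < part_size kW hub)%N by rewrite szW.
by exists w; rewrite lt0r_neq0.
Qed.

(** Explicit positive vector with [A z <= (n - a - 1) z]: the weights of clique and
    sinks are chosen so that equality holds there, and at the hub the inequality
    becomes the condition on the order. *)
Lemma large_hub_spectral (G : sgraph V) (a : nat)
    (s := part_size kappa hub) (t := part_size kappa sink) :
  subrel G (block_graph kappa) -> (0 < s)%N -> (a < t)%N ->
  (s * t * (s + (t - a)) <= (t - a) * (#|V| - a) * (#|V| - a - 1))%N ->
  spectral_radius G R <= (#|V| - a - 1)%:R.
Proof.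
move=> sub s0 at_; have := card_parts kappa; rewrite -/s -/t.
set q := part_size kappa clique => nE.
have [u tE] : exists u, t = (a + u)%N by exists (t - a)%N; rewrite subnKC // ltnW.
have u0 : (0 < u)%N by rewrite -(ltn_add2l a) addn0 -tE.
have -> : (#|V| - a - 1 = s + q + u - 1)%N by rewrite nE tE; lia.
have -> : (#|V| - a = s + q + u)%N by rewrite nE tE; lia.
have -> : (t - a = u)%N by rewrite tE addKn.
have th1 : (1 <= s + q + u)%N by lia.
rewrite -(ler_nat R) !natrM natrB // !natrD.
have S1 : 1 <= s%:R :> R by rewrite ler1n.
have U1 : 1 <= u%:R :> R by rewrite ler1n.
have Q0 : 0 <= q%:R :> R by [].
have T0 : 0 <= t%:R :> R by [].
move eS : (s%:R : R) S1 => S S1; move eU : (u%:R : R) U1 => U U1.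
move eQ : (q%:R : R) Q0 => Q Q0; move eT : (t%:R : R) T0 => T T0.
clear -sub eS eQ eT S1 U1 Q0 T0.
have [theta thE] : exists theta, theta = S + Q + U - 1 by exists (S + Q + U - 1).
have th0 : 0 < theta by lra.
have SU : 0 < S + U by lra.
rewrite -thE; have -> : S + Q + U = theta + 1 by rewrite thE; ring.
move=> main.
(* with hub weight 1, these weights solve the clique and sink equations exactly *)
have xq0 : 0 < S / (S + U) by rewrite divr_gt0 //; lra.
have xi0 : 0 < S / theta by rewrite divr_gt0 //; lra.
have z0 := fun v => weight_gt0 kappa v xq0 xi0.
apply: spectral_radius_le => [|b eb]; first exact: ltW.
apply: le_trans (ler_norm b) _; apply: (eigenvalue_le z0 _ eb) => v.
apply: le_trans (subgraph_nbr_sum v z0 sub) _.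
rewrite nbr_sum_weight /= -/s -/t -/q eS eQ eT.
have thN : theta != 0 by rewrite lt0r_neq0.
have SUN : S + U != 0 by rewrite lt0r_neq0.
case: (kappa v) => [[]|] /=.
- rewrite mulr1 -(ler_pM2l (mulr_gt0 th0 SU)).
  have -> : theta * (S + U) * (S - 1 + Q * (S / (S + U)) + T * (S / theta))
    = theta * (S + U) * (S - 1) + Q * S * theta + S * T * (S + U).
    by field; rewrite thN SUN.
  have QE : Q = theta + 1 - S - U by rewrite thE; ring.
  rewrite QE; clear -main; lra.
- by rewrite mulrCA divff // mulr1.
- have QE : Q = theta + 1 - S - U by rewrite thE; ring.
  rewrite le_eqVlt; apply/orP; left; apply/eqP; rewrite QE; by field.
Qed.

End Comparisons.

Lemma exists_subset_card (T : finType) (A : {set T}) m : (m <= #|A|)%N ->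
  exists2 B : {set T}, B \subset A & #|B| = m.
Proof.
move=> le; exists [set x in take m (enum A)].
  by apply/subsetP => x; rewrite inE => /mem_take; rewrite mem_enum.
rewrite cardsE; have /card_uniqP -> : uniq (take m (enum A)) by rewrite take_uniq // enum_uniq.
by rewrite size_takel // -cardE.
Qed.

Lemma min_degree_le (V : finType) (G : sgraph V) x : (min_degree G <= degree G x)%N.
Proof.
rewrite /min_degree; have := mem_index_enum x; elim: (index_enum _) => //= y s IH.
rewrite big_cons inE => /orP [/eqP -> |/IH le]; first exact: geq_minl.
by apply: leq_trans le; apply: geq_minr.
Qed.

Lemma connected_degree_gt0 (V : finType) (G : sgraph V) x :
  connected_graph G -> (1 < #|V|)%N -> (0 < degree G x)%N.
Proof.
move=> [_ conn]; rewrite -cardsT (cardsD1 x) inE /= add1n ltnS => /card_gt0P [y].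
rewrite !inE andbT => yx; have /connectP [p pth lst] := conn x y.
case: p pth lst => [_ /= e|z p /= /andP [xz _] _]; first by rewrite e eqxx in yx.
by apply/card_gt0P; exists z.
Qed.

Lemma connected_min_degree_gt0 (V : finType) (G : sgraph V) :
  connected_graph G -> (1 < #|V|)%N -> (0 < min_degree G)%N.
Proof.
move=> conn V2; rewrite /min_degree; elim/big_ind: _ => [|m n m0 n0|x _].
- exact: ltnW.
- by rewrite leq_min m0.
- exact: connected_degree_gt0.
Qed.

(** * Graphs with too many isolated vertices *)

Lemma order_gt1 (F : realFieldType) (k r n d : nat) : (0 < r)%N -> (r < k)%N ->
  (k%:R + r%:R) * (k%:R + 2 * r%:R) * (k%:R * d%:R + k%:R + r%:R) / (k%:R ^+ 2 * r%:R)
    <= n%:R :> F -> (1 < n)%N.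
Proof.
move=> r0 rk le; rewrite -(ltr_nat F); apply: lt_le_trans le.
have R0 : 0 < r%:R :> F by rewrite ltr0n.
have K0 : r%:R < k%:R :> F by rewrite ltr_nat.
have D0 : 0 <= d%:R :> F by [].
move: (r%:R : F) (k%:R : F) (d%:R : F) R0 K0 D0 => R K D R0 K0 D0.
have KR : 0 < K ^+ 2 * R by rewrite mulr_gt0 ?exprn_gt0 //; lra.
rewrite ltr_pdivlMr // mul1r -subr_gt0.
have -> : (K + R) * (K + 2 * R) * (K * D + K + R) - K ^+ 2 * R
  = (K + R) * (K + 2 * R) * (K * D) + K ^+ 3 + 3 * K ^+ 2 * R + 5 * K * R ^+ 2 + 2 * R ^+ 3 by ring.
rewrite ltr_wpDl ?mulr_gt0 ?exprn_gt0 // !addr_ge0 ?mulr_ge0 ?exprn_ge0 //; clear -R0 K0 D0; lra.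
Qed.

(** Given a set S violating the bound, take S as the hub and as many of the vertices
    isolated by S as sinks as the violation guarantees. A sink has all its
    neighbours in S, whence the bound on the minimum degree. *)
Lemma isolation_failure_parts (r k : nat) (V : finType) (G : sgraph V) : (0 < r)%N ->
  ~~ isolation_bound r k G ->
  exists kappa : V -> part,
    [/\ subrel G (block_graph kappa),
        part_size kappa sink = (k * part_size kappa hub %/ r + 1)%N
      & (min_degree G <= part_size kappa hub)%N].
Proof.
move=> r0 /forallPn [S]; rewrite -ltnNge => lt.
have le : (k * #|S| %/ r + 1 <= #|isolated_off G S|)%N.
  by rewrite addn1 ltn_divLR // [X in (_ < X)%N]mulnC.
have [I /subsetP subI cI] := exists_subset_card le.
have IS x : x \in I -> x \notin S by move=> /subI /isolated_offP [].
pose kappa x := if x \in S then hub else if x \in I then sink else clique.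
have kh x : (kappa x == hub) = (x \in S) by rewrite /kappa; case: (x \in S) => //; case: (x \in I).
have ks x : (kappa x == sink) = (x \in I).
  by rewrite /kappa; case: ifP => [xS|_]; [apply/esym; apply: contraTF xS; apply: IS | case: (x \in I)].
have hS : part_size kappa hub = #|S| by apply: eq_card => x; rewrite inE kh.
exists kappa; split.
- move=> x y xy; rewrite /= /block_rel /joined !kh !ks.
  have -> : x != y by apply: contraTneq xy => ->; rewrite edge_irr.
  rewrite andTb; apply/andP; split; apply/implyP => zI; have /isolated_offP [_ nb] := subI _ zI; apply: nb => //.
  by rewrite edge_sym.
- by rewrite hS -cI; apply: eq_card => x; rewrite inE ks.
- have /card_gt0P [x xI] : (0 < #|isolated_off G S|)%N by apply: leq_trans le; rewrite addn1.
  rewrite hS; apply: leq_trans (min_degree_le G x) _; apply: subset_leq_card.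
  by apply/subsetP => y xy; have /isolated_offP [_] := xI; apply.
Qed.

Theorem theorem1p1 (R : realType) (k r : nat) (V : finType) (G : sgraph V)
    (n delta : nat)
    (r_gt0 : (0 < r)%N) (k_gt0 : (0 < k)%N) (lt_rk : (r < k)%N)
    (G_conn : connected_graph G)
    (G_order : #|V| = n)
    (G_mindeg : min_degree G = delta)
    (n_ge : let K : rat := k%:R in let r' : rat := r%:R in
            let d : rat := delta%:R in
      Num.max
        ((K + r') * (K + 2 * r') * (K * d + K + r') / (K ^+ 2 * r'))
        ((2 * K * r' * d ^+ 2 + (2 * K ^+ 2 + K * r' + 2 * r' ^+ 2) * d
            + K ^+ 2 + 3 * K * r' - 2 * r' ^+ 2)
           / (2 * r' * (K - r')))
      <= n%:R)
    (rho_ge : spectral_radius (extremal_graph k r delta n) R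
                <= spectral_radius G R) :
  ~ graph_iso G (extremal_graph k r delta n) ->
  has_factor (cycle_tree_class k r) G.
Proof.
move=> not_iso; apply: isolation_bound_factor => //.
apply/negPn/negP => /(isolation_failure_parts r_gt0) [kappa [sub sinkE]].
rewrite G_mindeg => le_hub.
have n_gt1 : (1 < n)%N.
  have := n_ge; lazy zeta; rewrite ge_max => /andP [h _]; exact: order_gt1 h.
have delta_gt0 : (0 < delta)%N.
  by rewrite -G_mindeg; apply: connected_min_degree_gt0; rewrite ?G_order.
pose a := (k * delta %/ r + 1)%N.
have hub_gt0 := leq_trans delta_gt0 le_hub.
have := card_parts kappa; rewrite G_order => nE.
have le_a : (a <= part_size kappa sink)%N.
  by rewrite sinkE leq_add2r leq_div2r // leq_mul2l le_hub orbT.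
have le_n : (delta + a <= n)%N by lia.
pose q := (n - k * delta %/ r - delta - 1)%N.
have qE : q = (n - delta - a)%N by rewrite /q /a; lia.
pose kE := @ext_part delta q a.
have extE : extremal_graph k r delta n =2 block_rel kE by apply: ext_block.
have kEh : part_size kE hub = delta by rewrite ext_part_size.
have kEq : part_size kE clique = q by rewrite ext_part_size.
have kEs : part_size kE sink = a by rewrite ext_part_size.
have [eq_hub|ne_hub] := eqVneq (part_size kappa hub) delta.
  have szE c : part_size kE c = part_size kappa c.
    have sE : part_size kappa sink = a by rewrite sinkE eq_hub.
    case: c => [[]|]; [exact: etrans kEh (esym eq_hub) | exact: etrans kEs (esym sE) |].
    by apply: (etrans kEq); rewrite qE nE eq_hub sE -[None]/clique; lia.
  have sink_gt0 : (0 < part_size kappa sink)%N by rewrite sinkE addn1.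
  have [theta [_ lt ge]] := block_spectral R hub_gt0 sink_gt0.
  (* a graph equal to the block graph would be the excluded one *)
  have not_block : ~ (G =2 block_rel kappa).
    move=> GE; apply: not_iso; apply: block_iso GE extE _ => c; by rewrite szE.
  have := le_trans (ge _ _ _ extE szE) rho_ge.
  by rewrite leNgt (lt G sub G_conn.2 not_block).
have lt_hub : (delta < part_size kappa hub)%N by rewrite ltn_neqAle eq_sym ne_hub.
have le_hs : (part_size kappa hub + (k * part_size kappa hub %/ r + 1) <= n)%N.
  by rewrite -sinkE nE; lia.
have [at_ cond] := order_condition r_gt0 lt_rk delta_gt0 lt_hub le_hs n_ge.
rewrite -sinkE -/a in at_ cond.
have ub : spectral_radius G R <= (n - a - 1)%:R.
  by rewrite -G_order; apply: (@large_hub_spectral R V kappa); rewrite ?G_order.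
have kEh_gt0 : (0 < part_size kE hub)%N by rewrite kEh.
have kEs_gt0 : (0 < part_size kE sink)%N by rewrite kEs /a addn1.
have [theta [lt _ ge]] := block_spectral R kEh_gt0 kEs_gt0.
have := le_trans (ge _ _ _ extE (fun=> erefl)) (le_trans rho_ge ub).
rewrite leNgt; apply/negP/negPn; apply: le_lt_trans lt.
rewrite kEq kEh qE lerBrDr natr1 -natrD ler_nat.
lia.
Qed.
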